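(* Let $\ell$ be a positive integer. Let $\Sigma$ be a surface with Euler genus $g$. Let $G$ be a triangulation of $\Sigma$ with radius $r$ and order $n\ge(3\ell+1)((3+2g)r+1)$. Then $G$ has a subgraph $S$ with at most $(2r+1)(g+\ell)$ edges such that the induced embedding of $S$ in $\Sigma$ is 2-cell with exactly $\ell+1$ faces, and each face of $S$ contains at least $$\frac{n-\ell (3+2g)r-\ell}{2\ell+1}$$ vertices of $G$ in its interior.
   Context: A surface is a compact connected 2-manifold without boundary; the sphere with $h$ handles has Euler genus $2h$, the sphere with $c$ cross-caps has Euler genus $c$. A triangulation of a surface $\Sigma$ is a multigraph without loops embedded in $\Sigma$ such that each face is bounded by exactly 3 edges. Faces of an embedded (multi)graph are the connected components of the complement of the graph in the surface; an embedding is 2-cell if every face is homeomorphic to an open disc. *)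

(* Defs.v *)
From mathcomp Require Import all_boot all_order all_algebra.

Set Implicit Arguments.
Unset Strict Implicit.
Unset Printing Implicit Defensive.

Import GRing.Theory.

(* Graphs cellularly embedded in closed surfaces, orientable or not, are
   encoded by their flags.  A flag is one triangle (vertex v, midpoint of an
   edge e, centre of a face f) of the barycentric subdivision of the surface;
   [flip i] crosses the side of that triangle opposite to its corner of
   dimension i, that is, it changes the i-dimensional cell and keeps the
   other two.  The open cells of dimension i are thus the orbits of the two
   flips [flip j] with j != i. *)

Definition d0 : 'I_3 := @Ordinal 3 0 isT.
Definition d1 : 'I_3 := @Ordinal 3 1 isT.
Definition d2 : 'I_3 := @Ordinal 3 2 isT.

Record surface_graph := SurfaceGraph {
  flag : finType;
  flip : 'I_3 -> flag -> flag;
  flipK : forall i, involutive (flip i);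
  (* the surface has no boundary *)
  flip_neq : forall i x, flip i x != x;
  (* an edge has exactly four flags: two ends times two sides *)
  flip02C : forall x, flip d0 (flip d2 x) = flip d2 (flip d0 x);
  flip02_neq : forall x, flip d0 (flip d2 x) != x;
  (* the surface is nonempty and connected *)
  flag_gt0 : 0 < #|flag|;
  flag_conn : forall x y, connect [rel u v | [exists i, flip i u == v]] x y
}.

Section SurfaceGraphs.
Variable G : surface_graph.

Definition orb (i : 'I_3) (x : flag G) : {set flag G} :=
  [set y | connect [rel u v | [exists j, (j != i) && (flip j u == v)]] x y].

Definition vertex_at := orb d0.
Definition edge_at := orb d1.
Definition face_at := orb d2.

Definition vertices : {set {set flag G}} := [set vertex_at x | x : flag G].
Definition edges : {set {set flag G}} := [set edge_at x | x : flag G].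
Definition faces : {set {set flag G}} := [set face_at x | x : flag G].

(* The surface with h handles has Euler characteristic 2 - 2h and the one
   with c cross-caps has 2 - c, so Euler genus g means characteristic 2 - g,
   computed here from the cell structure given by the embedding. *)
Definition euler_char : int :=
  (#|vertices|%:Z - #|edges|%:Z + #|faces|%:Z)%R.

Definition has_euler_genus (g : nat) : Prop := euler_char = (2 - g%:Z)%R.

Definition loopless : Prop :=
  forall x : flag G, vertex_at (flip d0 x) <> vertex_at x.

(* A face whose boundary walk has length k has 2k flags.  Counting flags
   rather than distinct edges excludes faces that run twice along the same
   edge, such as the face of a noncontractible triangle in the projective
   plane. *)
Definition triangulation : Prop :=
  loopless /\ forall f, f \in faces -> #|f| = 6.

Definition adj : rel {set flag G} :=
  [rel u v | [exists x, (vertex_at x == u) && (vertex_at (flip d0 x) == v)]].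

Definition dist_le (u v : {set flag G}) (k : nat) : Prop :=
  exists p, [/\ path adj u p, last u p = v & size p <= k].

Definition ecc_le (u : {set flag G}) (k : nat) : Prop :=
  forall v, v \in vertices -> dist_le u v k.

Definition has_radius (r : nat) : Prop :=
  (exists2 u, u \in vertices & ecc_le u r) /\
  (forall u k, u \in vertices -> ecc_le u k -> r <= k).

Record subgraph := Subgraph {
  sverts : {set {set flag G}};
  sedges : {set {set flag G}};
  sverts_sub : sverts \subset vertices;
  sedges_sub : sedges \subset edges;
  sedges_ends : forall x, edge_at x \in sedges -> vertex_at x \in sverts
}.

(* The surface is the disjoint union of its open cells, so a union of open
   cells is represented by a set of pairs (dimension, cell). *)
Definition cell : finType := ('I_3 * {set flag G})%type.

Definition vcell x : cell := (d0, vertex_at x).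
Definition ecell x : cell := (d1, edge_at x).
Definition fcell x : cell := (d2, face_at x).

Definition cells : {set cell} :=
  [set vcell x | x : flag G] :|: [set ecell x | x : flag G]
    :|: [set fcell x | x : flag G].

Definition in_subgraph (S : subgraph) : {set cell} :=
  [set (d0, v) | v in sverts S] :|: [set (d1, e) | e in sedges S].

Definition outside (S : subgraph) : {set cell} := cells :\: in_subgraph S.

(* Of two distinct cells sharing a flag, one lies in the closure of the other;
   hence the connected components of the complement of S are the classes of
   cells outside S linked by chains of such incidences. *)
Definition linked (S : subgraph) : rel cell :=
  [rel a b | [&& a \in outside S, b \in outside S & a.2 :&: b.2 != set0]].

Definition sfaces (S : subgraph) : {set {set cell}} :=
  equivalence_partition (connect (linked S)) (outside S).

(* The unions of open cells that are homeomorphic to an open disc, generated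
   by: a single face; two disjoint open discs glued along an open edge that
   has one on each side; an open disc slit along a half-open edge, closed up
   by adding the open edge and that one of its ends (the vertex of x) around
   which everything else is already in the disc.  Every open disc that is a
   union of open cells arises in this way: glue its faces along a spanning
   tree of their adjacency graph, then zip up the remaining edges, which form
   a forest hanging from the boundary, starting from the leaves. *)
Inductive open_disc : {set cell} -> Prop :=
| disc_face (x : flag G) : open_disc [set fcell x]
| disc_glue (A B : {set cell}) (x : flag G) :
    open_disc A -> open_disc B -> [disjoint A & B] ->
    ecell x \notin A :|: B ->
    fcell x \in A -> fcell (flip d2 x) \in B ->
    open_disc (ecell x |: (A :|: B))
| disc_zip (A : {set cell}) (x : flag G) :
    open_disc A -> ecell x \notin A -> vcell x \notin A ->
    fcell x \in A -> fcell (flip d2 x) \in A ->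
    (forall y, y \in vertex_at x -> y <> x -> y <> flip d2 x ->
       ecell y \in A /\ fcell y \in A) ->
    open_disc (vcell x |: (ecell x |: A)).

Definition two_cell (S : subgraph) : Prop :=
  forall F, F \in sfaces S -> open_disc F.

Definition interior_vertices (F : {set cell}) : {set {set flag G}} :=
  [set v in vertices | (d0, v) \in F].

End SurfaceGraphs.

(* Main.v *)
Require Import Defs.
From mathcomp Require Import all_boot all_order all_algebra zify.

(* Fix a breadth-first spanning tree T of G, rooted at a centre, and a spanning
   tree of the dual graph whose edges avoid T; by Euler's formula exactly g
   edges of G lie in neither tree.  Cut the dual tree at a set C of l faces, each
   from its parent, and let S consist of the g extra edges, the l cut edges, and
   the T-paths from the ends of all these edges to the root.  Each block of the
   cut dual tree is a disc glued from its faces, and the rest of T zips up from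
   the leaves inside these discs, so the l + 1 blocks give the faces of S.

   The cuts are chosen greedily.  Among the faces f of the block of the root
   such that cutting at f yields a face with enough interior vertices, take the
   deepest one.  Its at most two children in the block do not qualify, and every
   other vertex lost by the block of the root lies on the T-path of one of the
   three corners of f; hence this block loses at most 3r vertices plus twice the
   threshold. *)

Set Implicit Arguments.
Unset Strict Implicit.
Unset Printing Implicit Defensive.

(** * Orbits of two fixed-point-free involutions *)

Section Dihedral.
Variables (T : finType) (a b : T -> T).
Hypotheses (aK : involutive a) (bK : involutive b).
Hypotheses (a_neq : forall x, a x != x) (b_neq : forall x, b x != x).

Definition dihedral_rot x := b (a x).
Local Notation s := dihedral_rot.

Definition dihedral_orbit x := [set y | fconnect s x y || fconnect s x (a y)].

Lemma dihedral_rot_inj : injective s.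
Proof. exact: inj_comp (inv_inj bK) (inv_inj aK). Qed.
Local Notation s_inj := dihedral_rot_inj.

(** The reflection [a] conjugates the rotation [s] to its inverse. *)
Lemma iter_dihedral_rot k x : iter k s (a (iter k s x)) = a x.
Proof.
elim: k => // k IH; rewrite -[in RHS]IH iterSr iterS; congr (iter k s _).
by rewrite /s aK bK.
Qed.

(** Cancelling half of the rotations turns an equality into a fixed point of [a] when [k] is even
    and of [b] when [k] is odd. *)
Lemma iter_dihedral_neq k x : iter k s x != a x.
Proof.
have inj_iter j : injective (iter j s) by elim: j => // j IH y z /s_inj /IH.
apply/eqP; rewrite -(odd_double_half k) -addnn; set j := k./2.
rewrite -(iter_dihedral_rot j x) addnCA iterD => /inj_iter.
case: (odd k) => /= /eqP; first by rewrite (negPf (b_neq _)).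
by rewrite eq_sym (negPf (a_neq _)).
Qed.

Lemma dihedral_orbit_id x : x \in dihedral_orbit x.
Proof. by rewrite inE connect0. Qed.

Lemma dihedral_orbit_a x y : y \in dihedral_orbit x -> a y \in dihedral_orbit x.
Proof. by rewrite !inE aK orbC. Qed.

Lemma dihedral_orbit_b x y : y \in dihedral_orbit x -> b y \in dihedral_orbit x.
Proof.
rewrite !inE => /orP[xy|xy].
  apply/orP; right; apply: connect_trans xy _.
  by rewrite (fconnect_sym s_inj) connect1 //= /s aK bK.
by apply/orP; left; apply: connect_trans xy _; rewrite connect1 //= /s aK.
Qed.

(** The orbit is the rotation cycle of [x] together with its mirror image under [a]; by
    [iter_dihedral_neq] the two are disjoint. *)
Lemma card_dihedral_orbit x : #|dihedral_orbit x| = (order s x).*2.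
Proof.
have -> : dihedral_orbit x = [set y | fconnect s x y] :|: a @^-1: [set y | fconnect s x y].
  by apply/setP=> y; rewrite !inE.
rewrite cardsU (_ : _ :&: _ = set0) ?cards0 ?subn0; last first.
  apply/setP=> y; rewrite !inE; apply/andP=> -[xy xay].
  have: fconnect s y (a y) by apply: connect_trans xay; rewrite (fconnect_sym s_inj).
  by case/iter_findex/eqP/idPn; apply: iter_dihedral_neq.
rewrite on_card_preimset; last by exists a => ? _; apply: aK.
by rewrite cardsE addnn.
Qed.

(* Deleting the edge joining [x] to [b x] from the alternating cycle through
   [x] leaves it connected. *)
Lemma dihedral_round (U : Type) (t : T -> U) x :
  (forall y, t (a y) = t y) ->
  (forall y, y \in dihedral_orbit x -> y != x -> y != b x -> t (b y) = t y) ->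
  t (b x) = t x.
Proof.
move=> ta tb.
have tk k : k < order s x -> t (iter k s x) = t x.
  elim: k => // k IH lt_k; rewrite iterS {1}/s tb ?ta ?IH ?(ltnW lt_k) //.
  - by rewrite dihedral_orbit_a // inE fconnect_iter.
  - by rewrite (can2_eq aK aK) iter_dihedral_neq.
  have sab : s (a (b x)) = x by rewrite /s aK bK.
  rewrite (can2_eq aK aK); apply/eqP=> /(congr1 s); rewrite sab -iterS.
  by move/(congr1 (findex s x)); rewrite findex_iter // findex0.
have xx := iter_order (s_inj) x; have := order_gt0 s x.
case E : (order s x) xx => [//|m] xx _.
by rewrite -{1}xx iterS {1}/s bK ta tk ?E.
Qed.

End Dihedral.

(** * Vertices, edges and faces as orbits of flags *)

Section FlagOrbits.
Variable G : surface_graph.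
Implicit Types x y : flag G.

Lemma orb_rel_sym (i : 'I_3) :
  connect_sym [rel u v : flag G | [exists j, (j != i) && (flip j u == v)]].
Proof.
apply: sym_connect_sym => u v /=; apply: eq_existsb => j.
by rewrite (can2_eq (@flipK G j) (@flipK G j)) [u == _]eq_sym.
Qed.

Lemma orb_id i x : x \in orb i x.
Proof. by rewrite inE connect0. Qed.

Lemma orb_eq i x y : y \in orb i x -> orb i y = orb i x.
Proof.
rewrite inE => xy; apply/setP=> z; rewrite !inE.
by rewrite (same_connect (orb_rel_sym i) xy).
Qed.

Lemma orb_eqP i x y : reflect (orb i y = orb i x) (y \in orb i x).
Proof. by apply: (iffP idP) => [/orb_eq //|<-]; apply: orb_id. Qed.

Lemma orb_mem_flip i j x y : j != i -> y \in orb i x -> flip j y \in orb i x.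
Proof.
rewrite !inE => ji xy; apply: connect_trans xy (connect1 _).
by apply/existsP; exists j; rewrite ji eqxx.
Qed.

Lemma orb_flip i j x : j != i -> orb i (flip j x) = orb i x.
Proof. by move=> ji; apply/orb_eqP/orb_mem_flip/orb_id. Qed.

Lemma orb_ind i x (P : flag G -> Prop) :
  P x -> (forall j y, j != i -> y \in orb i x -> P y -> P (flip j y)) ->
  forall y, y \in orb i x -> P y.
Proof.
move=> Px PS y; rewrite inE => /connectP[p e ->].
elim/last_ind: p e => //= p z IH; rewrite rcons_path last_rcons.
case/andP=> e /existsP[j /andP[ji /eqP <-]]; apply: PS => //; last exact: IH.
by rewrite inE; apply/connectP; exists p.
Qed.

Lemma edge_atP x y :
  reflect [\/ y = x, y = flip d0 x, y = flip d2 x | y = flip d0 (flip d2 x)]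
          (y \in edge_at x).
Proof.
apply: (iffP idP) => [|[]->]; last 1 first.
- by rewrite !orb_mem_flip ?orb_id.
- move: y; apply: orb_ind => [|j y]; first by constructor 1.
  case: j => -[|[|[|//]]] lt_j //= _ _ Hy.
    rewrite (_ : Ordinal _ = d0); last exact: val_inj.
    case: Hy => ->; rewrite ?flipK;
      by [constructor 1|constructor 2|constructor 3|constructor 4].
  rewrite (_ : Ordinal _ = d2); last exact: val_inj.
  case: Hy => ->; rewrite ?flipK -?flip02C ?flipK ?flip02C ?flipK;
    by [constructor 1|constructor 2|constructor 3|constructor 4].
- exact: orb_id.
- by rewrite orb_mem_flip ?orb_id.
- by rewrite orb_mem_flip ?orb_id.
Qed.

Lemma orb_dihedral (i j k : 'I_3) x : j != i -> k != i -> j != k ->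
  orb i x = dihedral_orbit (flip j) (flip k) x.
Proof.
move=> ji ki jk; apply/setP=> y; apply/idP/idP.
  move: y; apply: orb_ind => [|m y mi _]; first exact: dihedral_orbit_id.
  have [-> //|->] : m = j \/ m = k.
  - suff /orP[/eqP->|/eqP->] : (m == j) || (m == k) by [left|right|].
    move: ji ki jk mi; rewrite -!val_eqE /=.
    by case: i j k m => [i +] [j +] [k +] [m +] /=; lia.
  - by apply: dihedral_orbit_a; apply: flipK.
  - by apply: dihedral_orbit_b; apply: flipK.
have orb_s z : fconnect (dihedral_rot (flip j) (flip k)) x z -> z \in orb i x.
  move=> /iter_findex <-; elim: findex => [|n IH]; first exact: orb_id.
  by rewrite iterS /dihedral_rot !orb_mem_flip.
rewrite inE => /orP[/orb_s //|/orb_s /(orb_mem_flip ji)].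
by rewrite flipK.
Qed.

(** The flags at a vertex form one alternating cycle of [flip d1] and [flip d2], so the side of an
    edge can be changed by walking the other way round the vertex. *)
Lemma vertex_round (U : Type) (t : flag G -> U) x :
  (forall y, t (flip d1 y) = t y) ->
  (forall y, y \in vertex_at x -> y != x -> y != flip d2 x ->
     t (flip d2 y) = t y) ->
  t (flip d2 x) = t x.
Proof.
move=> t1 t2; apply: (dihedral_round (@flipK G d1) (@flipK G d2)) => //.
- exact: flip_neq.
- exact: flip_neq.
- by move=> y; rewrite -(@orb_dihedral d0) //; apply: t2.
Qed.

Lemma vertex_const (U : Type) (t : flag G -> U) x :
  (forall y, t (flip d1 y) = t y) ->
  (forall y, y \in vertex_at x -> t (flip d2 y) = t y) ->
  forall y, y \in vertex_at x -> t y = t x.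
Proof.
move=> t1 t2; apply: orb_ind => // j y j0 xy <-.
case: j j0 => -[|[|[|//]]] lt_j //= _.
  by rewrite (_ : Ordinal _ = d1) ?t1 //; apply: val_inj.
by rewrite (_ : Ordinal _ = d2) ?t2 //; apply: val_inj.
Qed.

(** Crossing to the other end of the edge and then to the other edge there rotates the face by one
    corner. *)
Definition face_turn : flag G -> flag G := dihedral_rot (flip d0) (flip d1).

(** In a triangle these flags represent the three corners; the other three flags are their images
    under [flip d0]. *)
Definition face_corners x := [:: x; face_turn x; face_turn (face_turn x)].

Lemma order_face_turn x : #|face_at x| = 6 -> order face_turn x = 3.
Proof.
move=> c6; apply: double_inj.
rewrite -(card_dihedral_orbit (@flipK G d0) (@flipK G d1)) -?(@orb_dihedral d2) //.
- exact: flip_neq.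
- exact: flip_neq.
Qed.

Lemma face_cornersP x y : #|face_at x| = 6 -> y \in face_at x ->
  exists2 z, z \in face_corners x & y = z \/ y = flip d0 z.
Proof.
move=> /order_face_turn o3; rewrite /face_at (@orb_dihedral d2 d0 d1) //.
have mem_corner z : fconnect face_turn x z -> z \in face_corners x.
  by rewrite fconnect_orbit /orbit o3.
rewrite inE => /orP[] /mem_corner zc; first by exists y => //; left.
by exists (flip d0 y) => //; right; rewrite flipK.
Qed.

Lemma face_corner_vertex x y : #|face_at x| = 6 -> y \in face_at x ->
  exists2 z, z \in face_corners x & vertex_at y = vertex_at z.
Proof.
move=> c6 /(face_cornersP c6)[z zc [->|->]]; first by exists z.
(* The far end of the edge of [z] is the vertex of the next corner, because [flip d1] keeps the
   vertex. *)
exists (face_turn z); last by rewrite /face_turn /dihedral_rot /vertex_at [RHS]orb_flip.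
have inj := dihedral_rot_inj (@flipK G d0) (@flipK G d1).
have s3 : face_turn (face_turn (face_turn x)) = x.
  by have := iter_order inj x; rewrite (order_face_turn c6).
by move: zc; rewrite /face_corners !inE => /or3P[] /eqP ->; rewrite ?s3 eqxx ?orbT.
Qed.

End FlagOrbits.

(** * Breadth-first depth *)

Section BFS.
Variables (A : finType) (e : rel A) (x0 : A).

(** The depth is the length of a shortest path from [x0], and [z] is the penultimate point of such a
    path. Depths of unreachable points are unconstrained. *)
Lemma bfs_depth : exists d : A -> nat,
  [/\ d x0 = 0,
      forall p, path e x0 p -> d (last x0 p) <= size p &
      forall y, connect e x0 y -> y != x0 ->
        exists z, [/\ connect e x0 z, e z y & d y = (d z).+1]].
Proof.
pose P y k := [exists t : k.-tuple A, path e x0 t && (last x0 t == y)].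
have PP y p : path e x0 p -> last x0 p = y -> P y (size p).
  by move=> ep <-; apply/existsP; exists (in_tuple p); rewrite /= ep eqxx.
have exP y : exists n, connect e x0 y -> P y n /\ forall k, P y k -> n <= k.
  have [/connectP[p ep ->]|] := boolP (connect e x0 y); last by exists 0.
  have exn : exists n, P (last x0 p) n by exists (size p); apply: PP.
  by exists (ex_minn exn) => _; case: ex_minnP => m Pm minm; split.
have [d dP] := fin_all_exists exP; exists d; split.
- by apply/eqP; rewrite -leqn0; apply: (proj2 (dP x0 (connect0 _ _))); apply: (PP _ [::]).
- move=> p ep; have /dP[_ +] : connect e x0 (last x0 p) by apply/connectP; exists p.
  by apply; apply: PP.
move=> y /[dup] cy /dP[/existsP[t /andP[et /eqP ly]] miny] yx.
have st := size_tuple t.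
case: (lastP t) et ly st => [_ /= ly|p z]; first by rewrite -ly eqxx in yx.
rewrite rcons_path last_rcons size_rcons => /andP[ep ez] zy st.
have cz : connect e x0 (last x0 p) by apply/connectP; exists p.
exists (last x0 p); split => //; first by rewrite -zy.
have [/existsP[t' /andP[et' /eqP lt']] minz] := dP _ cz.
apply/eqP; rewrite eqn_leq -{2}st ltnS minz ?PP // andbT.
have := miny (d (last x0 p)).+1; apply.
have := @PP y (rcons t' y); rewrite size_rcons size_tuple; apply.
  by rewrite rcons_path et' lt' -zy.
by rewrite last_rcons.
Qed.

End BFS.

(** * Rooted trees given by parent maps, and their blocks after cutting *)

Section RootedTree.
Variables (A : finType) (D : {set A}) (r0 : A) (d : A -> nat) (p : A -> A).

Record rooted_tree : Prop := RootedTree {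
  rt_root : r0 \in D;
  rt_depth0 : d r0 = 0;
  rt_parent : forall x, x \in D -> x != r0 -> p x \in D;
  rt_depthS : forall x, x \in D -> x != r0 -> d x = (d (p x)).+1
}.

(* The ancestors of [x], including [x] but not the root. *)
Definition branch x := [set y in traject p x (d x)].

(* The nearest ancestor of [x], possibly [x] itself, in [r0 |: C]. *)
Definition top (C : {set A}) x :=
  iter (d x) (fun y => if y \in r0 |: C then y else p y) x.

Hypothesis rt : rooted_tree.

Lemma rt_ind (P : A -> Prop) :
  P r0 -> (forall x, x \in D -> x != r0 -> P (p x) -> P x) ->
  forall x, x \in D -> P x.
Proof.
move=> P0 PS x; move: {2}(d x) (leqnn (d x)) => n.
elim: n x => [|n IH] x le_n Dx; have [-> //|x0] := eqVneq x r0.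
  by rewrite (rt_depthS rt Dx x0) in le_n.
apply: PS => //; apply: IH; last exact: rt_parent.
by rewrite -ltnS -(rt_depthS rt Dx x0).
Qed.

Lemma rt_parent_neq x : x \in D -> x != r0 -> p x != x.
Proof.
by move=> Dx x0; apply/eqP=> px; have := rt_depthS rt Dx x0; rewrite px; lia.
Qed.

Lemma branch_root : branch r0 = set0.
Proof. by apply/setP=> y; rewrite inE (rt_depth0 rt) !inE. Qed.

Lemma branchS x : x \in D -> x != r0 -> branch x = x |: branch (p x).
Proof. by move=> Dx x0; apply/setP=> y; rewrite inE (rt_depthS rt Dx x0) !inE. Qed.

Lemma card_branch x : #|branch x| <= d x.
Proof. by rewrite cardsE (leq_trans (card_size _)) ?size_traject. Qed.

Lemma mem_branch x : x \in D -> x != r0 -> x \in branch x.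
Proof. by move=> Dx x0; rewrite branchS // setU11. Qed.

Lemma branch_parent x y : x \in D -> y \in branch x -> p y \in r0 |: branch x.
Proof.
move: x; apply: rt_ind => [|x Dx x0 IH]; first by rewrite branch_root inE.
rewrite branchS // in_setU1 => /predU1P[->|/IH]; rewrite !inE.
  have [//|px0] := eqVneq (p x) r0.
  by rewrite -[_ \in traject _ _ _](in_set) mem_branch ?orbT // rt_parent.
by case/orP=> ->; rewrite ?orbT.
Qed.

Lemma branch_sub x : x \in D -> branch x \subset D :\ r0.
Proof.
move: x; apply: rt_ind => [|x Dx x0 IH]; first by rewrite branch_root sub0set.
by rewrite branchS // subUset IH sub1set !inE x0 Dx.
Qed.

Lemma top_in C x : x \in r0 |: C -> top C x = x.
Proof. by move=> Cx; rewrite /top; elim: (d x) => //= n ->; rewrite Cx. Qed.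

Lemma top_up C x : x \in D -> x \notin r0 |: C -> top C x = top C (p x).
Proof.
move=> Dx /[dup] Cx; rewrite {1}in_setU1 negb_or => /andP[x0 _].
by rewrite /top (rt_depthS rt Dx x0) iterSr (negPf Cx).
Qed.

Lemma top_mem C x : x \in D -> top C x \in r0 |: C.
Proof.
move: x; apply: rt_ind => [|x Dx x0 IH]; first by rewrite top_in setU11.
by have [Cx|Cx] := boolP (x \in r0 |: C); rewrite ?(top_in Cx) // top_up.
Qed.

(** Since [f] lies in the block of the root, the way up from [x] to its top in another block never
    meets [f]. *)
Lemma top_add_other C f x : top C f = r0 -> x \in D -> top C x != r0 ->
  top (f |: C) x = top C x.
Proof.
move=> Cf; move: x; apply: rt_ind => [|x Dx x0 IH].
  by rewrite top_in ?setU11 // eqxx.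
have [Cx|Cx] := boolP (x \in r0 |: C).
  by move=> _; rewrite !top_in //; move: Cx; rewrite !inE => /orP[]->; rewrite ?orbT.
rewrite (top_up Dx Cx) => Hx; rewrite top_up ?IH //.
have: x != f by apply: contraNneq Hx => xf; rewrite -(top_up Dx Cx) xf Cf.
by move: Cx; rewrite !inE; case: (x == r0); case: (x == f).
Qed.

Lemma top_add_root C f x : x \in D -> top C x = r0 ->
  top (f |: C) x = f \/ top (f |: C) x = r0.
Proof.
move: x; apply: rt_ind => [|x Dx x0 IH]; first by right; rewrite top_in ?setU11.
have [->|xf] := eqVneq x f; first by left; rewrite top_in // !inE eqxx orbT.
have [Cx|Cx] := boolP (x \in r0 |: C).
  by rewrite top_in // => x0'; rewrite x0' eqxx in x0.
rewrite top_up // => /IH; rewrite [top (f |: C) x]top_up //.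
by move: Cx xf; rewrite !inE; case: (x == r0); case: (x == f).
Qed.

Definition kids f := [set h in D | (h != r0) && (p h == f)].

(** The child [h] is the last ancestor of [x] before [f]. Thus what a cut at [f] detaches, apart
    from [f] itself, would also be detached by cuts at children of [f]. *)
Lemma top_kid C f x : x \in D -> x != f -> top C x = r0 -> top (f |: C) x = f ->
  exists h, [/\ h \in kids f, top C h = r0 & top (h |: C) x = h].
Proof.
move: x; apply: rt_ind => [|x Dx x0 IH] xf.
  by move=> _; rewrite top_in ?setU11 // => x0; rewrite x0 eqxx in xf.
have [Cx|Cx] := boolP (x \in r0 |: C).
  by rewrite top_in // => x0'; rewrite x0' eqxx in x0.
have CfxN : x \notin r0 |: (f |: C).
  by move: Cx xf; rewrite !inE; case: (x == r0); case: (x == f).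
move=> Cx0; rewrite top_up // => Cpf.
have [pf|pf] := eqVneq (p x) f.
  exists x; split=> //; first by rewrite !inE Dx x0 pf eqxx.
  by rewrite top_in // !inE eqxx orbT.
have [|h [kh Ch Chx]] := IH pf _ Cpf; first by rewrite -top_up.
exists h; split=> //; have [->|xh] := eqVneq x h.
  by rewrite top_in // !inE eqxx orbT.
rewrite top_up //.
by move: Cx xh; rewrite !inE; case: (x == r0); case: (x == h).
Qed.

End RootedTree.

(** * Spanning trees of the graph *)

Section VertexTree.
Variable G : surface_graph.
Variables (vr : {set flag G}) (vd : {set flag G} -> nat).
(* [tp v] is a flag of [v] on the edge from [v] to its parent; dually for [fp]. *)
Variable tp : {set flag G} -> flag G.

Definition vpar v : {set flag G} := vertex_at (flip d0 (tp v)).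

Record vertex_tree : Prop := VertexTree {
  vt_tree : rooted_tree (vertices G) vr vd vpar;
  vt_flag : forall v, v \in vertices G -> v != vr -> vertex_at (tp v) = v
}.

Definition tree_edges := [set edge_at (tp v) | v in vertices G :\ vr].

Hypothesis vt : vertex_tree.

Lemma vertex_atV x : vertex_at x \in vertices G.
Proof. exact: imset_f. Qed.

Lemma tree_edgesP y : edge_at y \in tree_edges ->
  exists2 v, v \in vertices G :\ vr /\ edge_at y = edge_at (tp v) &
    (vertex_at y = v /\ (y = tp v \/ y = flip d2 (tp v))) \/
    (vertex_at (flip d0 y) = v /\ vertex_at y = vpar v).
Proof.
case/imsetP=> v Vv /[dup] evE /orb_eqP/edge_atP yv; exists v => //.
have /(vt_flag vt) vv : v \in vertices G by case/setD1P: Vv.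
have {}vv : vertex_at (tp v) = v by apply: vv; case/setD1P: Vv.
have v2 x : vertex_at (flip d2 x) = vertex_at x by apply: orb_flip.
case: yv => ->; rewrite ?flipK ?v2 ?flip02C ?v2; [left|right|left|right]; split; auto.
Qed.

(* Outside an ancestor-closed set [Q] of vertices, a label of the corners that
   is unchanged across non-tree edges is unchanged across tree edges too: one
   can walk from one side of the edge joining [v] to its parent to the other
   around [v], crossing only non-tree edges and edges to children of [v]. *)
Lemma vertex_label (U : Type) (t : flag G -> U) (Q : {set {set flag G}}) :
  vr \in Q ->
  (forall v, v \in vertices G -> v != vr -> v \in Q -> vpar v \in Q) ->
  (forall y, t (flip d0 y) = t y) -> (forall y, t (flip d1 y) = t y) ->
  (forall y, vertex_at y \notin Q -> edge_at y \notin tree_edges ->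
     t (flip d2 y) = t y) ->
  forall y, vertex_at y \notin Q -> t (flip d2 y) = t y.
Proof.
move=> Qr Qpar t0 t1 t2.
(* Induction from the deepest vertices upwards. *)
pose M := \max_(v in vertices G) vd v.
have leM v : v \in vertices G -> vd v <= M by move=> Vv; apply: (leq_bigmax_cond _ Vv).
suff H n y : M - vd (vertex_at y) < n -> vertex_at y \notin Q -> t (flip d2 y) = t y.
  by move=> y; apply: H (ltnSn _).
elim: n y => // n IH y lt_n Qy; set v := vertex_at y.
have vr_neq : v != vr by apply: contraNneq Qy; rewrite -/v => ->.
have Vv : v \in vertices G := vertex_atV y.
have vv : vertex_at (tp v) = v by apply: (vt_flag vt).
(* An edge from [v] to a child [u] is crossed at the end [u], which is deeper and, as [Q] is closed
   under parents, also outside [Q]. *)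
have other z : vertex_at z = v -> z != tp v -> z != flip d2 (tp v) -> t (flip d2 z) = t z.
  move=> vz z1 z2; have [Tz|Tz] := boolP (edge_at z \in tree_edges); last first.
    by apply: t2; rewrite ?vz.
  case: (tree_edgesP Tz) => u [/setD1P[ur Vu] _] [[zu]|[zu vu]].
    by rewrite -zu vz => -[] zE; rewrite zE eqxx in z1 z2.
  rewrite -[t z]t0 -(IH (flip d0 z)) ?zu.
  - by rewrite -flip02C t0.
  - have := rt_depthS (vt_tree vt) Vu ur; rewrite -vu vz => dE.
    by have := leM u Vu; rewrite -/v in lt_n; lia.
  - by apply: contraNN Qy => /(Qpar _ Vu ur); rewrite -vu vz.
have round : t (flip d2 (tp v)) = t (tp v).
  apply: vertex_round => // z /orb_eqP zv; apply: other.
  by rewrite -[RHS]vv.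
have [->//|y1] := eqVneq y (tp v).
have [->|y2] := eqVneq y (flip d2 (tp v)); first by rewrite flipK.
exact: other.
Qed.

End VertexTree.

(** * Existence of a spanning tree of depth at most the radius *)

Section Existence.
Variable G : surface_graph.

Lemma flag_ind (P : flag G -> Prop) (x y : flag G) :
  P x -> (forall i z, P z -> P (flip i z)) -> P y.
Proof.
move=> Px PS; case/connectP: (flag_conn x y) => p e ->.
elim/last_ind: p e => //= p z IH; rewrite rcons_path last_rcons.
by case/andP=> /IH Pz /existsP[i /eqP<-]; apply: PS.
Qed.

Lemma vertex_tree_exists r : has_radius G r ->
  exists vr vd tp, vertex_tree vr vd tp /\
    forall v, v \in vertices G -> vd v <= r.
Proof.
case=> -[u Vu ecc] _.
have [d [du dle dS]] := bfs_depth (@adj G) u.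
have conn v : v \in vertices G -> connect (@adj G) u v.
  by move=> /ecc[p [pp <- _]]; apply/connectP; exists p.
have [x0 _] : exists x0 : flag G, true by have /card_gt0P[x _] := flag_gt0 G; exists x.
have /fin_all_exists[tp tpP] v : exists x : flag G,
    v \in vertices G -> v != u -> vertex_at x = v /\ d v = (d (vertex_at (flip d0 x))).+1.
  have [Vv|] := boolP (v \in vertices G); last by exists x0.
  have [|vu] := eqVneq v u; first by exists x0.
  have [z [_ /existsP[x /andP[/eqP xz /eqP xv]] dv]] := dS v (conn v Vv) vu.
  by exists (flip d0 x) => _ _; rewrite flipK xv xz.
exists u, d, tp; split; last first.
  by move=> v /ecc[p [pp <- sz]]; apply: leq_trans (dle _ pp) sz.
split; last by move=> v Vv /(tpP v Vv)[].
split=> // v Vv; first by move=> _; apply: vertex_atV.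
by move=> /(tpP v Vv)[].
Qed.

End Existence.

(** * The tree-cotree decomposition and its extra edges *)

Section DualTree.
Variable G : surface_graph.
Variables (vr : {set flag G}) (vd : {set flag G} -> nat).
Variable tp : {set flag G} -> flag G.
Hypothesis vt : vertex_tree vr vd tp.
Local Notation TE := (tree_edges vr tp).

Lemma faceF (x : flag G) : face_at x \in faces G.
Proof. exact: imset_f. Qed.

Variables (fr : {set flag G}) (fd : {set flag G} -> nat).
Variable fp : {set flag G} -> flag G.

Definition fpar f : {set flag G} := face_at (flip d2 (fp f)).

Record dual_tree : Prop := DualTree {
  dt_tree : rooted_tree (faces G) fr fd fpar;
  dt_flag : forall f, f \in faces G -> f != fr -> face_at (fp f) = f;
  dt_cotree : forall f, f \in faces G -> f != fr -> edge_at (fp f) \notin TE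
}.

Definition dual_edges := [set edge_at (fp f) | f in faces G :\ fr].

Hypothesis dt : dual_tree.

Lemma dual_edgesP y : edge_at y \in dual_edges ->
  exists2 h, h \in faces G :\ fr /\ edge_at y = edge_at (fp h) &
    (face_at y = h /\ face_at (flip d2 y) = fpar h) \/
    (face_at y = fpar h /\ face_at (flip d2 y) = h).
Proof.
case/imsetP=> h Fh /[dup] ehE /orb_eqP/edge_atP yh; exists h => //.
have hh : face_at (fp h) = h by case/setD1P: Fh => hr Fh; apply: (dt_flag dt).
have f0 (x : flag G) : face_at (flip d0 x) = face_at x by apply: orb_flip.
by case: yh => ->; rewrite ?flipK -?flip02C ?f0 ?flipK -?flip02C ?f0 ?flipK ?hh;
  [left|left|right|right].
Qed.

(** Two distinct vertices with the same parent edge would each be the parent of the other, which the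
    depths forbid. *)
Lemma tree_edge_inj : {in vertices G :\ vr &, injective (fun v => edge_at (tp v))}.
Proof.
move=> u v /setD1P[ur Vu] /setD1P[vr' Vv] /= uv.
have rt := vt_tree vt.
have step w w' : w \in vertices G -> w != vr -> w' \in vertices G -> w' != vr ->
    edge_at (tp w) = edge_at (tp w') -> w = w' \/ w = vpar tp w'.
  move=> Vw wr Vw' wr' /orb_eqP/edge_atP ww'.
  have := vt_flag vt Vw wr; have := vt_flag vt Vw' wr'.
  have v2 (x : flag G) : vertex_at (flip d2 x) = vertex_at x by apply: orb_flip.
  by case: ww' => ->; rewrite ?flip02C ?v2 => + <-; auto.
have [//|uE] := step u v Vu ur Vv vr' uv.
have [//|vE] := step v u Vv vr' Vu ur (esym uv).
have := rt_depthS rt Vu ur; have := rt_depthS rt Vv vr'; rewrite -uE -vE; lia.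
Qed.

(** The depth argument of [tree_edge_inj], in the dual graph. *)
Lemma dual_edge_inj : {in faces G :\ fr &, injective (fun f => edge_at (fp f))}.
Proof.
move=> u v /setD1P[ur Vu] /setD1P[vr' Vv] /= uv.
have rt := dt_tree dt.
have step w w' : w \in faces G -> w != fr -> w' \in faces G -> w' != fr ->
    edge_at (fp w) = edge_at (fp w') -> w = w' \/ w = fpar w'.
  move=> Vw wr Vw' wr' /orb_eqP/edge_atP ww'.
  have := dt_flag dt Vw wr; have := dt_flag dt Vw' wr'.
  have f0 (x : flag G) : face_at (flip d0 x) = face_at x by apply: orb_flip.
  by case: ww' => ->; rewrite ?f0 => + <-; auto.
have [//|uE] := step u v Vu ur Vv vr' uv.
have [//|vE] := step v u Vv vr' Vu ur (esym uv).
have := rt_depthS rt Vu ur; have := rt_depthS rt Vv vr'; rewrite -uE -vE; lia.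
Qed.

Lemma tree_edge_neq v f : v \in vertices G :\ vr -> f \in faces G :\ fr ->
  edge_at (tp v) != edge_at (fp f).
Proof.
move=> Vv /setD1P[fr' Ff]; apply: contraNneq (dt_cotree dt Ff fr') => <-.
exact: imset_f.
Qed.

Definition extra_edges := edges G :\: (TE :|: dual_edges).

(** With [V], [E], [F] the numbers of cells, the two trees use [V - 1] and [F - 1] distinct edges,
    and Euler's formula leaves [E - V - F + 2 = g]. *)
Lemma card_extra_edges g : has_euler_genus G g -> #|extra_edges| = g.
Proof.
rewrite /has_euler_genus /euler_char => hg.
have Vr : vr \in vertices G := rt_root (vt_tree vt).
have Fr : fr \in faces G := rt_root (dt_tree dt).
have cT : #|TE| = #|vertices G|.-1.
  by rewrite (card_in_imset tree_edge_inj) (cardsD1 vr (vertices G)) Vr.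
have cD : #|dual_edges| = #|faces G|.-1.
  by rewrite (card_in_imset dual_edge_inj) (cardsD1 fr (faces G)) Fr.
have cTD : #|TE :|: dual_edges| = #|TE| + #|dual_edges|.
  rewrite cardsU (_ : _ :&: _ = set0) ?cards0 ?subn0 //.
  apply/setP=> e; rewrite !inE; apply/andP=> -[/imsetP[v Vv ->]] /imsetP[f Ff /eqP].
  by apply/negP; apply: tree_edge_neq.
have sub : TE :|: dual_edges \subset edges G.
  by rewrite subUset; apply/andP; split; apply/subsetP=> e /imsetP[x _ ->]; apply: imset_f.
have := cardsID (TE :|: dual_edges) (edges G); rewrite (setIidPr sub) cTD cT cD.
have: 0 < #|vertices G| by apply/card_gt0P; exists vr.
have: 0 < #|faces G| by apply/card_gt0P; exists fr.
rewrite -/extra_edges; move: hg; clear.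
move: #|extra_edges| #|vertices G| #|faces G| #|edges G|; lia.
Qed.

End DualTree.

(** * Existence of a dual spanning tree avoiding the primal tree *)

Section DualExistence.
Variable G : surface_graph.
Variables (vr : {set flag G}) (vd : {set flag G} -> nat).
Variable tp : {set flag G} -> flag G.
Hypothesis vt : vertex_tree vr vd tp.
Local Notation TE := (tree_edges vr tp).

(** Reachability of faces without crossing the tree is a label [t] of flags. By [vertex_label] it is
    invariant under all flips, so every face is reached, and breadth-first search gives the tree. *)
Lemma dual_tree_exists : exists fr fd fp, dual_tree vr tp fr fd fp.
Proof.
have [x0 _] : exists x0 : flag G, true by have /card_gt0P[x _] := flag_gt0 G; exists x.
pose e := [rel f f' : {set flag G} | [exists x : flag G,
  [&& edge_at x \notin TE, face_at x == f & face_at (flip d2 x) == f']]].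
have e2 (x : flag G) : edge_at (flip d2 x) = edge_at x by apply: orb_flip.
have eP (x : flag G) : edge_at x \notin TE -> e (face_at x) (face_at (flip d2 x)).
  by move=> Tx; apply/existsP; exists x; rewrite Tx !eqxx.
pose t x := connect e (face_at x0) (face_at x).
have t0 x : t (flip d0 x) = t x by rewrite /t /face_at orb_flip.
have t1 x : t (flip d1 x) = t x by rewrite /t /face_at orb_flip.
have t2 x : edge_at x \notin TE -> t (flip d2 x) = t x.
  move=> Tx; apply/idP/idP => c; apply: connect_trans c (connect1 _); last exact: eP.
  by have := eP (flip d2 x); rewrite flipK e2; apply.
have tQ y : vertex_at y != vr -> t (flip d2 y) = t y.
  move=> yr; apply: (@vertex_label _ _ _ _ vt _ t [set vr]) => //; rewrite ?inE //; last by auto.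
  by move=> v _ /negPf vr'; rewrite inE vr'.
(* At the root, which [tQ] leaves out, a tree edge is crossed at its other end instead. *)
have tall y : t (flip d2 y) = t y.
  have [/eqP yr|/tQ //] := boolP (vertex_at y == vr).
  have [Ty|/t2 //] := boolP (edge_at y \in TE).
  have [v [/setD1P[vr' _] _] [[yv _]|[yv _]]] := tree_edgesP vt Ty.
    by rewrite -yv yr eqxx in vr'.
  by rewrite -[RHS]t0 -(tQ (flip d0 y)) ?yv // -flip02C t0.
have conn f : f \in faces G -> connect e (face_at x0) f.
  case/imsetP=> y _ ->; rewrite -/(t y); apply: (@flag_ind G t x0) => [|i z].
    exact: connect0.
  case: i => -[|[|[|//]]] lt_i.
  - by rewrite (_ : Ordinal _ = d0) ?t0 //; apply: val_inj.
  - by rewrite (_ : Ordinal _ = d1) ?t1 //; apply: val_inj.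
  - by rewrite (_ : Ordinal _ = d2) ?tall //; apply: val_inj.
have [d [du dle dS]] := bfs_depth e (face_at x0).
have /fin_all_exists[fp fpP] f : exists x : flag G,
    f \in faces G -> f != face_at x0 ->
    [/\ face_at x = f, edge_at x \notin TE & d f = (d (face_at (flip d2 x))).+1].
  have [Ff|] := boolP (f \in faces G); last by exists x0.
  have [|f0] := eqVneq f (face_at x0); first by exists x0.
  have [z [_ /existsP[x /and3P[Tx /eqP xz /eqP xf]] dv]] := dS f (conn f Ff) f0.
  by exists (flip d2 x) => _ _; rewrite flipK xz e2.
exists (face_at x0), d, fp; split.
- split=> // [|f Ff _|f Ff]; rewrite ?faceF //.
  by move=> /(fpP f Ff)[].
- by move=> f Ff /(fpP f Ff)[].
- by move=> f Ff /(fpP f Ff)[].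
Qed.

End DualExistence.

Lemma leq_card_bigcup (I T : finType) (P : {set I}) (F : I -> {set T}) k :
  (forall i, i \in P -> #|F i| <= k) -> #|\bigcup_(i in P) F i| <= #|P| * k.
Proof.
move=> leF; rewrite -sum_nat_const.
have: #|\bigcup_(i in P) F i| <= \sum_(i in P) #|F i|.
  elim/big_rec2: _ => [|i n A _ le_n]; first by rewrite cards0.
  by rewrite (leq_trans (leq_card_setU _ _)) ?leq_add2l.
by move/leq_trans; apply; apply: leq_sum.
Qed.

(** * The subgraph determined by a set of cuts *)

Section Cuts.
Variable G : surface_graph.
Variables (vr : {set flag G}) (vd : {set flag G} -> nat).
Variable tp : {set flag G} -> flag G.
Hypothesis vt : vertex_tree vr vd tp.
Variables (fr : {set flag G}) (fd : {set flag G} -> nat).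
Variable fp : {set flag G} -> flag G.
Hypothesis dt : dual_tree vr tp fr fd fp.
Local Notation V := (vertices G).
Local Notation F := (faces G).
Local Notation rtV := (vt_tree vt).
Local Notation rtF := (dt_tree dt).

Implicit Types (C : {set {set flag G}}) (x y : flag G).

Definition cut_edges C := extra_edges vr tp fr fp :|: [set edge_at (fp c) | c in C].

(* The vertex set of the subgraph [S] belonging to the cuts [C]. *)
Definition hull C :=
  vr |: \bigcup_(x in [set x | edge_at x \in cut_edges C])
           branch vd (vpar tp) (vertex_at x).

(** A block of the cut dual tree is named by its top face; this label sends a flag to the block of
    its face. *)
Definition ftop C x := top fr fd (fpar fp) C (face_at x).

Lemma hullP C v : reflect
  (v = vr \/ exists2 x, edge_at x \in cut_edges C & v \in branch vd (vpar tp) (vertex_at x))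
  (v \in hull C).
Proof.
rewrite in_setU1; apply: (iffP predU1P) => -[->|]; try by left.
  by case/bigcupP=> x; rewrite inE => Cx vx; right; exists x.
by case=> x Cx vx; right; apply/bigcupP; exists x; rewrite // inE.
Qed.

Lemma hull_root C : vr \in hull C. Proof. exact: setU11. Qed.

Lemma hull_vertices C : hull C \subset V.
Proof.
apply/subsetP=> v /hullP[->|[x _ /(subsetP (branch_sub rtV (vertex_atV x)))]].
  exact: (rt_root rtV).
by case/setD1P.
Qed.

Lemma hull_parent C v : v \in hull C -> v != vr -> vpar tp v \in hull C.
Proof.
case/hullP=> [->|[x Cx vx _]]; first by rewrite eqxx.
have := branch_parent rtV (vertex_atV x) vx; rewrite in_setU1 => /predU1P[->|px].
  exact: hull_root.
by apply/hullP; right; exists x.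
Qed.

Lemma hull_cut_end C x : edge_at x \in cut_edges C -> vertex_at x \in hull C.
Proof.
move=> Cx; apply/hullP; have [->|xr] := eqVneq (vertex_at x) vr; first by left.
by right; exists x => //; apply: (mem_branch rtV (vertex_atV x) xr).
Qed.

(** Each cut edge contributes the paths from its two ends, each with at most [r] vertices besides
    the root. *)
Lemma card_hull C r : (forall v, v \in V -> vd v <= r) ->
  #|hull C :\ vr| <= #|cut_edges C| * (2 * r).
Proof.
move=> vd_le; have [x0 _] : exists x0 : flag G, true.
  by have /card_gt0P[x _] := flag_gt0 G; exists x.
(* One flag per edge; the default [x0] is never taken on an edge, which is nonempty. *)
pose rep (e : {set flag G}) := odflt x0 [pick x in e].
pose B x := branch vd (vpar tp) (vertex_at x).
have sub : hull C :\ vr \subset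
    \bigcup_(e in cut_edges C) (B (rep e) :|: B (flip d0 (rep e))).
  apply/subsetP=> v /setD1P[vr' /hullP[vE|[x Cx vx]]]; first by rewrite vE eqxx in vr'.
  apply/bigcupP; exists (edge_at x) => //; rewrite /rep.
  case: pickP => [z /=|/(_ x)]; last by rewrite orb_id.
  move=> /orb_eq xz; have /edge_atP : x \in edge_at z by apply/orb_eqP.
  have v2 y : vertex_at (flip d2 y) = vertex_at y by apply: orb_flip.
  rewrite inE /B; case=> xE; rewrite xE ?flip02C ?v2 in vx; rewrite ?vx ?orbT //.
apply: leq_trans (subset_leq_card sub) _; apply: leq_card_bigcup => e _.
rewrite mul2n -addnn (leq_trans (leq_card_setU _ _)) // leq_add //;
  by rewrite (leq_trans (card_branch _ _ _)) // vd_le ?vertex_atV.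
Qed.

Lemma ftop0 C y : ftop C (flip d0 y) = ftop C y.
Proof. by rewrite /ftop /face_at orb_flip. Qed.

Lemma ftop1 C y : ftop C (flip d1 y) = ftop C y.
Proof. by rewrite /ftop /face_at orb_flip. Qed.

(** An uncut dual tree edge separates a face from its parent, and both belong to the same block. *)
Lemma ftop_dual C y h : h \in F :\ fr -> edge_at y = edge_at (fp h) -> h \notin C ->
  ftop C (flip d2 y) = ftop C y /\ ftop C y = top fr fd (fpar fp) C h.
Proof.
move=> Fh yh Ch; have Dy : edge_at y \in dual_edges fr fp by rewrite yh; apply: imset_f.
have [k [Fk yk] yE] := dual_edgesP dt Dy.
have kh : k = h by apply: (dual_edge_inj dt) => //=; rewrite -yk -yh.
rewrite kh in yE.
have up : top fr fd (fpar fp) C h = top fr fd (fpar fp) C (fpar fp h).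
  case/setD1P: Fh => hr Fh; apply: (top_up rtF) => //.
  by rewrite in_setU1 negb_or hr.
by rewrite /ftop; case: yE => -[-> ->]; rewrite up.
Qed.

(** This is [vertex_label] with the hull as [Q]: a non-tree edge at a vertex outside the hull cannot
    be a cut edge, so it is an uncut edge of the dual tree. *)
Lemma ftop2 C y : vertex_at y \notin hull C -> ftop C (flip d2 y) = ftop C y.
Proof.
apply: (vertex_label vt) => //.
- exact: hull_root.
- by move=> v _ vr' Cv; apply: hull_parent.
- exact: ftop0.
- exact: ftop1.
move=> {}y Cy Ty; have [Dy|Dy] := boolP (edge_at y \in dual_edges fr fp).
  have [h [Fh yh] _] := dual_edgesP dt Dy.
  apply: (proj1 (ftop_dual Fh yh _)); apply: contraNN Cy => Ch.
  by apply/hull_cut_end/setUP; right; rewrite yh; apply: imset_f.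
case/negP: Cy; apply: hull_cut_end; rewrite !inE (negPf Ty) (negPf Dy) /=.
by rewrite imset_f.
Qed.

Lemma ftop_vertex C y z : vertex_at y \notin hull C -> vertex_at z = vertex_at y ->
  ftop C z = ftop C y.
Proof.
move=> Cy /orb_eqP; apply: (vertex_const (ftop1 C)) => w /orb_eqP wy.
by apply: ftop2; rewrite /vertex_at wy.
Qed.

(** By [ftop_vertex], all faces at a vertex outside the hull lie in one block, so a single flag
    decides membership. *)
Definition inner C c := [set v in V | (v \notin hull C) &&
  [exists x, (vertex_at x == v) && (ftop C x == c)]].

Lemma innerP C c x : (vertex_at x \in inner C c) =
  (vertex_at x \notin hull C) && (ftop C x == c).
Proof.
rewrite inE vertex_atV /=; apply: andb_id2l => Cx.
apply/existsP/eqP => [[y /andP[/eqP yx /eqP <-]]|xc]; first exact/esym/ftop_vertex.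
by exists x; rewrite eqxx xc eqxx.
Qed.

Definition skel_edges C := cut_edges C :|: [set edge_at (tp v) | v in hull C :\ vr].

Lemma skel_edges_sub C : skel_edges C \subset edges G.
Proof.
rewrite !subUset subsetDl /=; apply/andP.
by split; apply/subsetP=> e /imsetP[z _ ->]; apply: imset_f.
Qed.

Lemma skel_edges_ends C x : edge_at x \in skel_edges C -> vertex_at x \in hull C.
Proof.
case/setUP=> [/hull_cut_end //|/imsetP[v /setD1P[vr' Cv] xv]].
have Vv := subsetP (hull_vertices C) v Cv.
have: edge_at x \in tree_edges vr tp by rewrite xv; apply: imset_f; rewrite in_setD1 vr'.
case/(tree_edgesP vt) => u [Vu xu].
have -> : u = v by apply: (tree_edge_inj vt) => //=; rewrite -?xu // in_setD1 vr'.
by case=> [[-> _ //]|[_ ->]]; apply: hull_parent.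
Qed.

Definition skel C : subgraph G :=
  Subgraph (hull_vertices C) (skel_edges_sub C) (@skel_edges_ends C).

(** There are at most [g + #|C|] cut edges, and each brings at most [2 * r] tree edges with it. *)
Lemma card_skel_edges C g r : has_euler_genus G g ->
  (forall v, v \in V -> vd v <= r) ->
  #|skel_edges C| <= (2 * r + 1) * (g + #|C|).
Proof.
move=> hg vd_le; have cC : #|cut_edges C| <= g + #|C|.
  rewrite -(card_extra_edges vt dt hg) (leq_trans (leq_card_setU _ _)) //.
  by rewrite leq_add2l leq_imset_card.
have cT : #|[set edge_at (tp v) | v in hull C :\ vr]| <= #|cut_edges C| * (2 * r).
  by rewrite (leq_trans (leq_imset_card _ _)) ?card_hull.
rewrite (leq_trans (leq_card_setU _ _)) // mulnDl mul1n addnC mulnC leq_add //.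
by rewrite (leq_trans cT) // leq_mul2r cC orbT.
Qed.

(** Such an edge is an uncut dual edge or a tree edge; in the latter case its child end is outside
    the hull and [ftop2] applies there. *)
Lemma ftop_edge C y : edge_at y \notin skel_edges C -> ftop C (flip d2 y) = ftop C y.
Proof.
rewrite in_setU negb_or => /andP[Cy Ty].
have [Dy|Dy] := boolP (edge_at y \in dual_edges fr fp).
  have [h [Fh yh] _] := dual_edgesP dt Dy.
  apply: (proj1 (ftop_dual Fh yh _)); apply: contraNN Cy => Ch.
  by apply/setUP; right; rewrite yh; apply: imset_f.
have [T'y|T'y] := boolP (edge_at y \in tree_edges vr tp); last first.
  by case/negP: Cy; rewrite !inE (negPf T'y) (negPf Dy) /= imset_f.
have [v [Vv yv] yE] := tree_edgesP vt T'y.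
have Cv : v \notin hull C.
  apply: contraNN Ty => Cv; rewrite yv; apply: imset_f; rewrite in_setD1 Cv andbT.
  by case/setD1P: Vv.
case: yE => -[vy _]; first by rewrite ftop2 ?vy.
by rewrite -[RHS]ftop0 -(@ftop2 _ (flip d0 y)) ?vy // -flip02C ftop0.
Qed.

End Cuts.

(** * Components of the complement of a subgraph *)

Section Cells.
Variable G : surface_graph.
Implicit Types (x y : flag G) (S : subgraph G).

Lemma cellsP (a : cell G) : reflect (exists x, a = (a.1, orb a.1 x)) (a \in cells G).
Proof.
rewrite !inE -orbA; apply: (iffP or3P) => [[] /imsetP[x _ ->]|[x ->]]; try by exists x.
case: a.1 => -[|[|[|//]]] lt_i.
- by constructor 1; rewrite (_ : Ordinal _ = d0); [apply: imset_f | apply: val_inj].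
- by constructor 2; rewrite (_ : Ordinal _ = d1); [apply: imset_f | apply: val_inj].
- by constructor 3; rewrite (_ : Ordinal _ = d2); [apply: imset_f | apply: val_inj].
Qed.

Lemma cell_flag (a : cell G) x : a \in cells G -> x \in a.2 -> a = (a.1, orb a.1 x).
Proof. by case/cellsP=> y -> /= /orb_eq ->. Qed.

Lemma cell_cases (P : cell G -> Prop) :
  (forall x, P (vcell x)) -> (forall x, P (ecell x)) -> (forall x, P (fcell x)) ->
  forall a, a \in cells G -> P a.
Proof.
by move=> Pv Pe Pf a; rewrite !inE -orbA => /or3P[] /imsetP[x _ ->].
Qed.

Lemma mem_pair_imset (i j : 'I_3) (e : {set flag G}) (A : {set {set flag G}}) :
  ((i, e) \in [set (j, v) | v in A]) = (i == j) && (e \in A).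
Proof.
apply/imsetP/andP => [[v Av [-> ->]]|[/eqP -> Ae]]; first by rewrite eqxx.
by exists e.
Qed.

Lemma vcell_outside S x : (vcell x \in outside S) = (vertex_at x \notin sverts S).
Proof.
rewrite in_setD in_setU !mem_pair_imset /= orbF; case: (_ \in sverts S) => //=.
by apply/cellsP; exists x.
Qed.

Lemma ecell_outside S x : (ecell x \in outside S) = (edge_at x \notin sedges S).
Proof.
rewrite in_setD in_setU !mem_pair_imset /=; case: (_ \in sedges S) => //=.
by apply/cellsP; exists x.
Qed.

Lemma fcell_outside S x : fcell x \in outside S.
Proof.
by rewrite in_setD in_setU !mem_pair_imset /=; apply/cellsP; exists x.
Qed.

Lemma linked_flag S a b x : a \in outside S -> b \in outside S ->
  x \in a.2 -> x \in b.2 -> linked S a b.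
Proof.
by move=> Sa Sb ax bx; apply/and3P; split=> //; apply/set0Pn; exists x; rewrite inE ax.
Qed.

Lemma linked_sym S : connect_sym (linked S).
Proof. by apply: sym_connect_sym => a b; apply/and3P/and3P => -[? ?]; rewrite setIC. Qed.

Lemma open_disc_nonempty (A : {set cell G}) : open_disc A -> exists x, fcell x \in A.
Proof.
elim=> [x|B D x _ [y By] *|B x _ [y By] *]; first by exists x; rewrite inE.
  by exists y; rewrite !inE By orbT.
by exists y; rewrite !inE By !orbT.
Qed.

(** Induction on the construction: the edge added in a gluing or zipping step is incident to every
    piece it joins, and serves as base point. *)
Lemma open_disc_connected S (A : {set cell G}) : open_disc A -> A \subset outside S ->
  {in A &, forall a b, connect (linked S) a b}.
Proof.
move=> dA; elim: dA => {A} [x|A B x dA IA dB IB dAB ex Ax Bx|A x dA IA ex vx Ax A2x _].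
- by move=> _ a b /set1P-> /set1P->; apply: connect0.
- move=> sS; suff H a : a \in ecell x |: (A :|: B) -> connect (linked S) (ecell x) a.
    by move=> a b /H xa /H xb; apply: connect_trans xb; rewrite linked_sym.
  have Sin b : b \in ecell x |: (A :|: B) -> b \in outside S by apply: subsetP.
  have Se : ecell x \in outside S by apply: Sin; rewrite setU11.
  have sA : A \subset outside S.
    by apply/subsetP=> b Ab; apply: Sin; rewrite !inE Ab orbT.
  have sB : B \subset outside S.
    by apply/subsetP=> b Bb; apply: Sin; rewrite !inE Bb !orbT.
  case/setU1P=> [-> //|/setUP[Aa|Ba]].
    apply: connect_trans (IA sA _ _ Ax Aa); apply/connect1/(@linked_flag _ _ _ x) => //.
    - exact: (subsetP sA).
    - exact: orb_id.
    - exact: orb_id.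
  apply: connect_trans (IB sB _ _ Bx Ba).
  apply/connect1/(@linked_flag _ _ _ (flip d2 x)) => //.
  - exact: (subsetP sB).
  - exact/orb_mem_flip/orb_id.
  - exact: orb_id.
- move=> sS; suff H a : a \in vcell x |: (ecell x |: A) -> connect (linked S) (ecell x) a.
    by move=> a b /H xa /H xb; apply: connect_trans xb; rewrite linked_sym.
  have Sin b : b \in vcell x |: (ecell x |: A) -> b \in outside S by apply: subsetP.
  have Se : ecell x \in outside S by apply: Sin; rewrite !inE eqxx orbT.
  have Sv : vcell x \in outside S by apply: Sin; rewrite !inE eqxx.
  have sA : A \subset outside S.
    by apply/subsetP=> b Ab; apply: Sin; rewrite !inE Ab !orbT.
  case/setU1P=> [->|/setU1P[-> //|Aa]].
    by apply/connect1/(@linked_flag _ _ _ x) => //; apply: orb_id.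
  apply: connect_trans (IA sA _ _ Ax Aa); apply/connect1/(@linked_flag _ _ _ x) => //.
  - exact: (subsetP sA).
  - exact: orb_id.
  - exact: orb_id.
Qed.

(** Discs are connected and nonempty, so discs that cover the complement and are closed under
    incidence are its components. *)
Lemma sfaces_eq S (I : finType) (J : {set I}) (R : I -> {set cell G}) :
  (forall a, a \in outside S -> exists2 j, j \in J & a \in R j) ->
  (forall j, j \in J -> R j \subset outside S) ->
  (forall j, j \in J -> open_disc (R j)) ->
  (forall j a b, j \in J -> linked S a b -> a \in R j -> b \in R j) ->
  sfaces S = [set R j | j in J].
Proof.
move=> cov sub disc clos.
have classE j a : j \in J -> a \in R j -> [set b in outside S | connect (linked S) a b] = R j.
  move=> Jj ja; apply/setP=> b; rewrite inE; apply/andP/idP => [[Sb]|jb]; last first.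
    split; first exact: (subsetP (sub j Jj)).
    exact: (open_disc_connected (disc j Jj) (sub j Jj)).
  case/connectP=> p pp ->; elim: p a ja pp => //= c p IH a ja /andP[ac pp].
  exact: IH (clos j a c Jj ac ja) pp.
apply/setP=> A; apply/imsetP/imsetP => [[a Sa ->]|[j Jj ->]].
  by have [j Jj ja] := cov a Sa; exists j => //; apply: classE.
have [x jx] := open_disc_nonempty (disc j Jj).
by exists (fcell x); [apply: (subsetP (sub j Jj)) | apply/esym/classE].
Qed.

End Cells.

Lemma setU1_glue (T : finType) (x y : T) (A B : {set T}) :
  (x |: A) :|: (y |: B) = y |: (A :|: B :|: [set x]).
Proof. by rewrite setUACA [A :|: B :|: _]setUC [RHS]setUA [[set y] :|: [set x]]setUC. Qed.

Lemma setU1_zip (T : finType) (x y : T) (A B D : {set T}) :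
  (x |: A) :|: (y |: B) :|: D = x |: (y |: (A :|: B :|: D)).
Proof. by rewrite setUACA -!setUA. Qed.

(** * The faces of the subgraph are open discs *)

Section Regions.
Variable G : surface_graph.
Variables (vr : {set flag G}) (vd : {set flag G} -> nat).
Variable tp : {set flag G} -> flag G.
Hypothesis vt : vertex_tree vr vd tp.
Variables (fr : {set flag G}) (fd : {set flag G} -> nat).
Variable fp : {set flag G} -> flag G.
Hypothesis dt : dual_tree vr tp fr fd fp.
Local Notation V := (vertices G).
Local Notation F := (faces G).
Local Notation rtV := (vt_tree vt).
Local Notation rtF := (dt_tree dt).
Local Notation ftop := (ftop fr fd fp).
Local Notation ftree := (top fr fd (fpar fp)).
Local Notation hull := (hull vr vd tp fr fp).
Local Notation inner := (inner vr vd tp fr fd fp).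

Implicit Types (C Q U : {set {set flag G}}) (x y : flag G).

(** When [Q] is a subtree of the dual tree with top [c], the edges listed are the dual tree edges
    inside [Q]. *)
Definition glued c Q : {set cell G} :=
  [set (d2, f) | f in Q] :|: [set (d1, edge_at (fp h)) | h in Q :\ c].

Lemma mem_glued_face c Q f : ((d2, f) \in glued c Q) = (f \in Q).
Proof.
rewrite in_setU mem_pair_imset eqxx /=; case: (f \in Q) => //=.
by apply/imsetP=> -[h _ []].
Qed.

Lemma mem_glued_edge c Q e :
  ((d1, e) \in glued c Q) = (e \in [set edge_at (fp h) | h in Q :\ c]).
Proof.
rewrite in_setU mem_pair_imset /=.
by apply/imsetP/imsetP=> -[h Qh]; [case=> -> | move=> ->]; exists h.
Qed.

Lemma mem_glued_vertex c Q v : ((d0, v) \in glued c Q) = false.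
Proof. by rewrite in_setU mem_pair_imset /=; apply/imsetP=> -[h _ []]. Qed.

(** Remove a deepest face [h]: it has no child in [Q], so the rest is still closed under parents and
    is a disc by induction. *)
Lemma glued_disc c Q : c \in Q -> Q \subset F ->
  (forall h, h \in Q -> h != c -> h != fr /\ fpar fp h \in Q) ->
  open_disc (glued c Q).
Proof.
move: {2}#|Q| (leqnn #|Q|) => n; elim: n Q => [|n IH] Q le_n Qc sQ up.
  by move: le_n; rewrite leqn0 cards_eq0 => /eqP Q0; rewrite Q0 inE in Qc.
have [/eqP Qc0|/set0Pn[h0 Qh0]] := boolP (Q :\ c == set0).
  have -> : Q = [set c] by rewrite -(setD1K Qc) Qc0 setU0.
  have /imsetP[x _ ->] : c \in F := subsetP sQ c Qc.
  by rewrite /glued setDv imset_set1 imset0 setU0; apply: disc_face.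
have [h Qh maxh] : exists2 h, h \in Q :\ c & forall k, k \in Q :\ c -> fd k <= fd h.
  by case: (arg_maxnP fd Qh0) => h ? ?; exists h.
case/setD1P: (Qh) => hc Qh'; have [hr Qp] := up h Qh' hc.
have Fh := subsetP sQ h Qh'.
(* The gluing flag is taken on the side of the parent, which lies in the larger disc. *)
have dE : glued c Q = ecell (flip d2 (fp h)) |: (glued c (Q :\ h) :|: [set fcell (fp h)]).
  have e2 : edge_at (flip d2 (fp h)) = edge_at (fp h) by apply: orb_flip.
  rewrite /ecell e2 /fcell (dt_flag dt Fh hr).
  rewrite /glued -setU1_glue; congr (_ :|: _).
    by rewrite -[in LHS](setD1K Qh') imsetU1.
  by rewrite -[in LHS](setD1K Qh) imsetU1 !setDDl [[set h; c]]setUC.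
rewrite dE; apply: disc_glue.
- apply: IH.
  + by move: le_n; rewrite (cardsD1 h Q) Qh'.
  + by rewrite in_setD1 eq_sym hc.
  + exact: subset_trans (subsetDl _ _) sQ.
  move=> k /setD1P[kh Qk] kc; have [kr Qpk] := up k Qk kc; split=> //.
  rewrite in_setD1 Qpk andbT; apply/eqP=> pk.
  have := maxh k; rewrite in_setD1 kc Qk => /(_ isT).
  by rewrite (rt_depthS rtF (subsetP sQ k Qk) kr) pk ltnn.
- exact: disc_face.
- rewrite disjoint_sym disjoints1 mem_glued_face (dt_flag dt Fh hr).
  by rewrite in_setD1 eqxx.
- rewrite in_setU negb_or /ecell mem_glued_edge in_set1 andbT.
  have -> : edge_at (flip d2 (fp h)) = edge_at (fp h) by apply: orb_flip.
  apply/imsetP=> -[k /setD1P[kc /setD1P[kh Qk]] hk].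
  have Fk := subsetP sQ k Qk; have [kr _] := up k Qk kc.
  move/negP: kh; apply; apply/eqP/esym/(dual_edge_inj dt) => //; exact/setD1P.
- by rewrite mem_glued_face in_setD1 Qp andbT (rt_parent_neq rtF Fh hr).
- by rewrite flipK in_set1.
Qed.

Section Region.
Variables (C : {set {set flag G}}) (c : {set flag G}).
Hypotheses (sC : C \subset F :\ fr) (cC : c \in fr |: C).

Let Q := [set f in F | ftree C f == c].

Let Fc : c \in F.
Proof.
case/setU1P: cC => [->|/(subsetP sC)/setD1P[]//]; exact: (rt_root rtF).
Qed.

Let Q_up h : h \in Q -> h != c -> h \notin fr |: C.
Proof.
rewrite inE => /andP[Fh /eqP hc] hc'; apply: contra hc' => Ch.
by rewrite -hc top_in.
Qed.

Let Q_disc : open_disc (glued c Q).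
Proof.
apply: glued_disc.
- by rewrite inE Fc top_in ?eqxx.
- by apply/subsetP=> f; rewrite inE => /andP[].
move=> h Qh hc; have Ch := Q_up Qh hc; move: Qh; rewrite inE => /andP[Fh /eqP hcE].
have hr : h != fr by apply: contraNneq Ch => ->; rewrite setU11.
by split=> //; rewrite inE (rt_parent rtF) //= -(top_up rtF) ?hcE.
Qed.

Definition zipped U : {set cell G} :=
  [set (d0, v) | v in U] :|: [set (d1, edge_at (tp v)) | v in U].

Lemma mem_zipped_vertex U v : ((d0, v) \in zipped U) = (v \in U).
Proof.
rewrite in_setU mem_pair_imset eqxx /=; case: (v \in U) => //=.
by apply/imsetP=> -[h _ []].
Qed.

Lemma mem_zipped_edge U e :
  ((d1, e) \in zipped U) = (e \in [set edge_at (tp v) | v in U]).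
Proof.
rewrite in_setU mem_pair_imset /=.
by apply/imsetP/imsetP=> -[h Qh]; [case=> -> | move=> ->]; exists h.
Qed.

Lemma mem_zipped_face U f : ((d2, f) \in zipped U) = false.
Proof. by rewrite in_setU mem_pair_imset /=; apply/imsetP=> -[h _ []]. Qed.

Let inner_sub v : v \in inner C c -> v \in V :\ vr.
Proof.
rewrite inE in_setD1 => /and3P[Vv Cv _]; rewrite Vv andbT.
by apply: contraNneq Cv => ->; apply: hull_root.
Qed.

(** Both ends of the parent edge see a common face, and a child in the hull would put its parent
    there. *)
Let inner_child u : u \in V :\ vr -> vpar tp u \in inner C c -> u \in inner C c.
Proof.
case/setD1P=> ur Vu; have uE := vt_flag vt Vu ur.
rewrite /vpar -[in X in _ -> X]uE !(innerP vt dt) ftop0 uE => /andP[Cpu ->]; rewrite andbT.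
by apply: contraNN Cpu => Cu; apply: (hull_parent vt).
Qed.

(** The vertex [v] of least depth in [U] is zipped last. By then the edges from [v] to its children
    are zipped already, and its remaining edges other than the parent edge were glued. *)
Let zipped_disc U : U \subset inner C c ->
  (forall u, u \in V :\ vr -> vpar tp u \in U -> u \in U) ->
  open_disc (zipped U :|: glued c Q).
Proof.
move: {2}#|U| (leqnn #|U|) => n; elim: n U => [|n IH] U le_n sU down.
  move: le_n; rewrite leqn0 cards_eq0 => /eqP ->.
  by rewrite /zipped !imset0 !set0U; apply: Q_disc.
have [->|/set0Pn[v0 Uv0]] := eqVneq U set0.
  by rewrite /zipped !imset0 !set0U; apply: Q_disc.
have [v Uv minv] : exists2 v, v \in U & forall k, k \in U -> vd v <= vd k.
  by case: (arg_minnP vd Uv0) => v ? ?; exists v.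
have Iv := subsetP sU v Uv; have Vv := inner_sub Iv; case/setD1P: (Vv) => vr' Vv'.
have vE := vt_flag vt Vv' vr'.
have v2E : vertex_at (flip d2 (tp v)) = v by rewrite -[RHS]vE; apply: orb_flip.
have fQ x : vertex_at x = v -> fcell x \in zipped (U :\ v) :|: glued c Q.
  move=> xv; apply/setUP; right; rewrite mem_glued_face inE faceF.
  by move: Iv; rewrite -xv (innerP vt dt) => /andP[].
have -> : zipped U :|: glued c Q =
    vcell (tp v) |: (ecell (tp v) |: (zipped (U :\ v) :|: glued c Q)).
  rewrite /vcell vE /zipped -setU1_zip; congr (_ :|: _ :|: _).
    by rewrite -[in LHS](setD1K Uv) imsetU1.
  by rewrite -[in LHS](setD1K Uv) imsetU1.
apply: disc_zip.
- apply: IH.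
  + by move: le_n; rewrite (cardsD1 v U) Uv.
  + exact: subset_trans (subsetDl _ _) sU.
  move=> u Vu /setD1P[_ Uu]; rewrite in_setD1 down // andbT; apply/eqP=> uv.
  have := minv _ Uu; case/setD1P: Vu => ur Vu; rewrite -uv (rt_depthS rtV Vu ur).
  by rewrite ltnn.
- rewrite in_setU negb_or mem_zipped_edge mem_glued_edge; apply/andP; split.
    apply/imsetP=> -[u /setD1P[uv Uu]] /(tree_edge_inj vt Vv) vu.
    by rewrite vu ?eqxx // in uv; apply/inner_sub/(subsetP sU).
  apply/imsetP=> -[h /setD1P[hc Qh] /eqP]; apply/negP; apply: (tree_edge_neq dt) => //.
  have Ch := Q_up Qh hc; move: Qh; rewrite inE => /andP[Fh _].
  by rewrite in_setD1 Fh andbT; apply: contraNneq Ch => ->; rewrite setU11.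
- by rewrite in_setU mem_zipped_vertex mem_glued_vertex orbF vE in_setD1 eqxx.
- exact: fQ.
- exact: fQ.
move=> y /orb_eq yv y1 y2; have {}yv : vertex_at y = v by rewrite -[RHS]vE.
split; last exact: fQ.
rewrite in_setU mem_zipped_edge mem_glued_edge.
move: Iv; rewrite -yv (innerP vt dt) => /andP[Cy /eqP yc].
(* A tree edge at [v] other than its parent edge leads to a child, which is in [U]. A non-tree edge
   is an uncut dual edge, as [v] is outside the hull. *)
have [Ty|Ty] := boolP (edge_at y \in tree_edges vr tp).
  have [u [Vu yu] [[vyu yE]|[_ pu]]] := tree_edgesP vt Ty.
    by rewrite -vyu yv in yE; case: yE.
  have Uu : u \in U by apply: down; rewrite // -pu yv.
  apply/orP; left; rewrite yu; apply: imset_f; rewrite in_setD1 Uu andbT.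
  case/setD1P: Vu => ur Vu; apply/eqP=> uv; move: (rt_parent_neq rtV Vu ur).
  by rewrite -pu -uv eqxx.
have [Dy|Dy] := boolP (edge_at y \in dual_edges fr fp); last first.
  case/negP: Cy; apply: (hull_cut_end vt); rewrite !inE (negPf Ty) (negPf Dy) /=.
  by rewrite imset_f.
have [h [Fh yh] _] := dual_edgesP dt Dy.
have Ch : h \notin C.
  apply: contraNN Cy => Ch; apply/(hull_cut_end vt)/setUP; right; rewrite yh; exact: imset_f.
apply/orP; right; rewrite yh; apply: imset_f; rewrite in_setD1 inE.
have [_ <-] := ftop_dual dt Fh yh Ch; rewrite yc eqxx andbT.
case/setD1P: Fh => hr ->; rewrite andbT; apply: contraTneq cC => <-.
by rewrite in_setU1 negb_or hr.
Qed.

Local Notation skel := (skel vt fr fp).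

Definition region : {set cell G} :=
  [set a in outside (skel C) | [exists x, (x \in a.2) && (ftop C x == c)]].

(** The block label is constant on each cell outside the subgraph, so components can be read off
    from flags. *)
Lemma ftop_cell a x y : a \in outside (skel C) -> x \in a.2 -> y \in a.2 ->
  ftop C y = ftop C x.
Proof.
move=> Sa; have: a \in cells G by case/setDP: Sa.
move/cell_flag => aE xa; have := Sa; rewrite (aE x xa) {aE xa}.
case: a.1 => -[|[|[|//]]] lt_i.
- rewrite (_ : Ordinal _ = d0); last exact: val_inj.
  by rewrite vcell_outside /= => Cx /orb_eq; apply: (ftop_vertex vt dt).
- rewrite (_ : Ordinal _ = d1); last exact: val_inj.
  rewrite ecell_outside /= => /(ftop_edge vt dt) e2 /edge_atP[] ->; by rewrite ?ftop0 ?e2.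
- rewrite (_ : Ordinal _ = d2); last exact: val_inj.
  by move=> _ /orb_eq fE; rewrite /ftop /face_at fE.
Qed.

Lemma mem_region a x : a \in outside (skel C) -> x \in a.2 ->
  (a \in region) = (ftop C x == c).
Proof.
move=> Sa xa; rewrite inE Sa; apply/existsP/eqP => [[y /andP[ya /eqP <-]]|xc].
  exact: (ftop_cell Sa).
by exists x; rewrite xa xc eqxx.
Qed.

(** An edge outside the subgraph is either the parent edge of a vertex outside the hull or an uncut
    dual edge; these are the zipped and the glued edges. *)
Let regionE : region = zipped (inner C c) :|: glued c Q.
Proof.
have fC h : h \in Q :\ c -> h \in F :\ fr /\ h \notin C.
  case/setD1P=> hc Qh; have := Q_up Qh hc; rewrite in_setU1 negb_or => /andP[hr ->].
  by move: Qh; rewrite inE in_setD1 hr => /andP[->].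
apply/setP=> a; have [Ca|Ca] := boolP (a \in cells G); last first.
  transitivity false; first by apply: contraNF Ca; rewrite inE => /andP[/setDP[]].
  apply/esym; apply: contraNF Ca => /setUP[]/setUP[] /imsetP[z Hz ->].
  - by move: Hz => /inner_sub /setD1P[_ /imsetP[x _ ->]]; apply/cellsP; exists x.
  - by apply/cellsP; exists (tp z).
  - by move: Hz; rewrite inE => /andP[/imsetP[x _ ->] _]; apply/cellsP; exists x.
  - by apply/cellsP; exists (fp z).
move: a Ca; apply: cell_cases => x.
- rewrite in_setU mem_zipped_vertex mem_glued_vertex orbF (innerP vt dt).
  have [Cx|Cx] := boolP (vcell x \in outside (skel C)).
    by rewrite (mem_region Cx (orb_id _ _)); move: Cx; rewrite vcell_outside => ->.
  by rewrite inE (negPf Cx); move: Cx; rewrite vcell_outside negbK /= => ->.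
- rewrite in_setU mem_zipped_edge mem_glued_edge; apply/idP/orP.
    move=> Rx; have Sx : ecell x \in outside (skel C) by move: Rx; rewrite inE => /andP[].
    move: Rx; rewrite (mem_region Sx (orb_id _ _)) => /eqP xc.
    move: Sx; rewrite ecell_outside in_setU negb_or => /andP[Cx Tx].
    have [T'x|T'x] := boolP (edge_at x \in tree_edges vr tp).
      left; have [v [Vv xv] xE] := tree_edgesP vt T'x; rewrite xv; apply: imset_f.
      have Cv : v \notin hull C.
        apply: contraNN Tx => Cv; rewrite xv; apply: imset_f; rewrite in_setD1 Cv andbT.
        by case/setD1P: Vv.
      by case: xE Cv => -[<- _]; rewrite (innerP vt dt) ?ftop0 xc eqxx andbT.
    have [Dx|Dx] := boolP (edge_at x \in dual_edges fr fp); last first.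
      by case/negP: Cx; rewrite !inE (negPf T'x) (negPf Dx) /= imset_f.
    have [h [Fh xh] _] := dual_edgesP dt Dx.
    have Ch : h \notin C.
      by apply: contraNN Cx => Ch; apply/setUP; right; rewrite xh; apply: imset_f.
    right; rewrite xh; apply: imset_f; rewrite in_setD1 inE.
    have [_ <-] := ftop_dual dt Fh xh Ch; rewrite xc eqxx andbT.
    case/setD1P: Fh => hr ->; rewrite andbT; apply: contraTneq cC => <-.
    by rewrite in_setU1 negb_or hr.
  case=> /imsetP[z Hz xz].
    have Vz := inner_sub Hz.
    have zE : vertex_at (tp z) = z by case/setD1P: Vz => ? ?; apply: (vt_flag vt).
    have Sx : ecell x \in outside (skel C).
      have Tz : edge_at (tp z) \in tree_edges vr tp by apply: imset_f.
      rewrite ecell_outside xz in_setU negb_or in_setU negb_or !inE Tz /=.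
      apply/andP; split.
        apply/imsetP=> -[h Ch /eqP]; apply/negP/(tree_edge_neq dt) => //.
        exact: (subsetP sC).
      apply/imsetP=> -[u /setD1P[ur Cu] /(tree_edge_inj vt Vz)] zu.
      have Vu : u \in V :\ vr by rewrite in_setD1 ur (subsetP (hull_vertices vt fr fp C)).
      by move: Hz; rewrite (zu Vu) inE Cu andbF.
    have zx : tp z \in edge_at x by apply/orb_eqP.
    by rewrite (mem_region Sx zx); move: Hz; rewrite -{1}zE (innerP vt dt) => /andP[].
  have [Fz Cz] := fC z Hz.
  have Sx : ecell x \in outside (skel C).
    have Dz : edge_at (fp z) \in dual_edges fr fp by apply: imset_f.
    rewrite ecell_outside xz in_setU negb_or in_setU negb_or !inE Dz orbT /=.
    apply/andP; split.
      apply/imsetP=> -[h Ch] /(dual_edge_inj dt Fz) zh.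
      by move: Cz; rewrite zh ?Ch //; apply: (subsetP sC).
    apply/imsetP=> -[u /setD1P[ur Cu] /eqP]; rewrite eq_sym.
    apply/negP/(tree_edge_neq dt) => //.
    by rewrite in_setD1 ur; apply: (subsetP (hull_vertices vt fr fp C)).
  rewrite (mem_region Sx (orb_id _ _)); have [_ ->] := ftop_dual dt Fz xz Cz.
  by move: Hz; rewrite in_setD1 inE => /and3P[].
rewrite in_setU mem_zipped_face mem_glued_face (mem_region (fcell_outside _ _) (orb_id _ _)).
by rewrite /= [RHS]inE faceF.
Qed.

Lemma region_disc : open_disc region.
Proof. by rewrite regionE; apply: zipped_disc => // u; apply: inner_child. Qed.

Lemma region_interior : interior_vertices region = inner C c.
Proof.
apply/setP=> v; rewrite inE regionE in_setU mem_zipped_vertex mem_glued_vertex orbF.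
by apply: andb_idl; rewrite inE => /andP[].
Qed.

End Region.

(** Linked cells share a flag, hence a label, so each region is closed under linkage. *)
Lemma skel_sfaces C : C \subset F :\ fr ->
  sfaces (skel vt fr fp C) = [set region C c | c in fr |: C].
Proof.
move=> sC; apply: sfaces_eq.
- move=> a Sa; have /cellsP[x aE] : a \in cells G by case/setDP: Sa.
  exists (ftop C x); first by apply: (top_mem rtF); apply: faceF.
  by rewrite (@mem_region _ _ _ x) // aE orb_id.
- by move=> c _; apply/subsetP=> a; rewrite inE => /andP[].
- by move=> c; apply: region_disc.
move=> c a b _ /and3P[Sa Sb /set0Pn[x /setIP[xa xb]]].
by rewrite (mem_region _ Sa xa) (mem_region _ Sb xb).
Qed.

Lemma card_skel_sfaces C : C \subset F :\ fr ->
  #|sfaces (skel vt fr fp C)| = #|C| + 1.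
Proof.
move=> sC; have frC : fr \notin C.
  by apply/negP=> /(subsetP sC); rewrite in_setD1 eqxx.
rewrite skel_sfaces // card_in_imset ?cardsU1 ?frC 1?addnC //.
move=> c c' Cc _ /setP RE; have [x] := open_disc_nonempty (region_disc sC Cc).
move=> Rx; have := RE (fcell x); rewrite Rx; move: Rx.
rewrite !(mem_region _ (fcell_outside _ _) (orb_id _ _)) => /eqP <- /esym/eqP //.
Qed.

End Regions.

(** * The effect of one further cut *)

Section Greedy.
Variable G : surface_graph.
Variables (vr : {set flag G}) (vd : {set flag G} -> nat).
Variable tp : {set flag G} -> flag G.
Hypothesis vt : vertex_tree vr vd tp.
Variables (fr : {set flag G}) (fd : {set flag G} -> nat).
Variable fp : {set flag G} -> flag G.
Hypothesis dt : dual_tree vr tp fr fd fp.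
Local Notation V := (vertices G).
Local Notation F := (faces G).
Local Notation rtV := (vt_tree vt).
Local Notation rtF := (dt_tree dt).
Local Notation ftop := (ftop fr fd fp).
Local Notation ftree := (top fr fd (fpar fp)).
Local Notation hull := (hull vr vd tp fr fp).
Local Notation inner := (inner vr vd tp fr fd fp).
Local Notation vbranch := (branch vd (vpar tp)).
Local Notation fkids := (kids F fr (fpar fp)).

Implicit Types (C : {set {set flag G}}) (x y : flag G) (c f h v : {set flag G}).

(** The tree paths from the corners of [f] to the root, without the root. *)
Definition fbranch f := \bigcup_(x in f) vbranch (vertex_at x).

(** The ends of the new cut edge are corners of both [f] and its parent. Both memberships are kept
    because [inner_split] considers cuts at [f] and at children of [f]. *)
Lemma hull_add C f v : f \in F :\ fr -> v \in hull (f |: C) ->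
  v \in hull C \/ (v \in fbranch f /\ v \in fbranch (fpar fp f)).
Proof.
case/setD1P=> fr' Ff /hullP[->|[x Cx vx]]; first by left; apply: hull_root.
have {Cx} [Cx|xf] : edge_at x \in cut_edges vr tp fr fp C \/ edge_at x = edge_at (fp f).
  move: Cx; rewrite /cut_edges imsetU1 !in_setU in_set1.
  by case/or3P=> [->|/eqP->|->]; rewrite ?orbT; auto.
  by left; apply/hullP; right; exists x.
right; have v2 y : vertex_at (flip d2 y) = vertex_at y by apply: orb_flip.
have fE := dt_flag dt Ff fr'.
have Fin y z : vertex_at x = vertex_at z -> face_at z = face_at y -> v \in fbranch (face_at y).
  by move=> xz zy; apply/bigcupP; exists z; rewrite -?xz // -zy orb_id.
have f0 y : face_at (flip d0 y) = face_at y by apply: orb_flip.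
have [xE|xE] : vertex_at x = vertex_at (fp f) \/ vertex_at x = vertex_at (flip d0 (fp f)).
- have /edge_atP : x \in edge_at (fp f) by apply/orb_eqP.
  case=> ->.
  + by left.
  + by right.
  + by left.
  + by right; rewrite flip02C.
- rewrite -{1}fE; split; first exact: (Fin _ (fp f)).
  by apply: (Fin _ (flip d2 (fp f))); rewrite ?v2.
rewrite -{1}fE; split; first exact: (Fin _ (flip d0 (fp f))).
by apply: (Fin _ (flip d0 (flip d2 (fp f)))); rewrite // flip02C v2.
Qed.

Hypothesis tri : forall f, f \in F -> #|f| = 6.

Lemma card_fbranch r f : (forall v, v \in V -> vd v <= r) -> f \in F ->
  #|fbranch f| <= 3 * r.
Proof.
move=> vd_le Ff; have := tri Ff; case/imsetP: Ff => x _ -> c6.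
have sub : fbranch (face_at x) \subset
    \bigcup_(z in [set z in face_corners x]) vbranch (vertex_at z).
  apply/bigcupsP=> y /(face_corner_vertex c6)[z zc ->].
  by apply/subsetP=> v vz; apply/bigcupP; exists z => //; rewrite in_set.
apply: leq_trans (subset_leq_card sub) _.
have le_b z : z \in [set z in face_corners x] -> #|vbranch (vertex_at z)| <= r.
  by move=> _; rewrite (leq_trans (card_branch _ _ _)) // vd_le ?vertex_atV.
apply: leq_trans (leq_card_bigcup le_b) _; rewrite leq_mul2r cardsE.
by rewrite (leq_trans (card_size _)) ?orbT.
Qed.

Lemma kid_corner f x h : f \in F -> x \in f -> h \in fkids f ->
  exists2 z, z \in face_corners x & h = face_at (flip d2 z).
Proof.
move=> Ff xf; have c6 := tri Ff; have /imsetP[y _ fE] := Ff.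
rewrite inE => /and3P[Fh hr /eqP hf].
have fx : f = face_at x by move: xf; rewrite fE => /orb_eq/esym.
have hE := dt_flag dt Fh hr.
have : flip d2 (fp h) \in face_at x by apply/orb_eqP; rewrite -[RHS]fx.
case/(face_cornersP _) => [|z zc zE]; first by rewrite -fx.
exists z => //; rewrite -hE -[fp h](flipK d2).
case: zE => ->; rewrite ?flipK // -flip02C; exact: orb_flip.
Qed.

Lemma card_kids_root f : f \in F -> #|fkids f| <= 3.
Proof.
move=> Ff; have /imsetP[x _ fE] := Ff.
have sub : fkids f \subset [seq face_at (flip d2 z) | z <- face_corners x].
  apply/subsetP=> h /(kid_corner Ff (x := x))[|z zc ->]; first by rewrite fE orb_id.
  by apply/mapP; exists z.
by apply: leq_trans (subset_leq_card sub) _; rewrite (leq_trans (card_size _)) ?size_map.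
Qed.

(** One of the three sides of [f] leads to its parent, which is not a child because of its depth. *)
Lemma card_kids f : f \in F -> f != fr -> #|fkids f| <= 2.
Proof.
move=> Ff fr'; have fE := dt_flag dt Ff fr'.
have sub : fkids f \subset
    [seq face_at (flip d2 z) | z <- [:: face_turn (fp f); face_turn (face_turn (fp f))]].
  apply/subsetP=> h /[dup] kh /(kid_corner Ff (x := fp f))[|z]; first by rewrite -{2}fE orb_id.
  rewrite /face_corners in_cons => /predU1P[->|zc] hE; last by apply/mapP; exists z.
  move: kh; rewrite inE => /and3P[Fh hr /eqP hf].
  have := rt_depthS rtF Fh hr; have := rt_depthS rtF Ff fr'.
  by rewrite hf -[fpar fp f]/(face_at _) -hE; lia.
by apply: leq_trans (subset_leq_card sub) _; rewrite (leq_trans (card_size _)) ?size_map.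
Qed.

(** Off [fbranch f], a cut at [f] or at a child of [f] does not put the vertex into the hull, so
    only the block of its face [face_at x] matters. *)
Lemma inner_split C f v : f \in F -> v \in inner C fr ->
  [\/ v \in fbranch f, f != fr /\ v \in inner (f |: C) fr |
      exists h, [/\ h \in fkids f, ftree C h = fr & v \in inner (h |: C) h]].
Proof.
move=> Ff /[dup]; rewrite {1}inE => /andP[/imsetP[x _ ->] _]; rewrite (innerP vt dt).
case/andP=> Cx /eqP xfr; have [bx|bx] := boolP (vertex_at x \in fbranch f).
  by constructor 1.
have xr : vertex_at x != vr by apply: contraNneq Cx => ->; apply: hull_root.
have xf : face_at x != f.
  apply: contraNneq bx => <-; apply/bigcupP; exists x; rewrite ?orb_id //.
  exact: (mem_branch rtV (vertex_atV x)).
have kid : ftop (f |: C) x = f ->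
    exists h, [/\ h \in fkids f, ftree C h = fr & vertex_at x \in inner (h |: C) h].
  case/(top_kid rtF (faceF x) xf xfr)=> h [kh hC hx]; exists h; split=> //.
  rewrite (innerP vt dt) [ftop _ _]hx eqxx andbT; apply/negP.
  move: kh; rewrite inE => /and3P[Fh hr /eqP hf].
  case/hull_add; rewrite ?in_setD1 ?hr // ?(negPf Cx) // hf => -[_].
  exact/negP.
(* If [f] is the root face, both outcomes of [top_add_root] name [f], so the face of [x] hangs below
   a child. *)
have [/eqP ffr|fr'] := boolP (f == fr).
  by constructor 3; apply: kid; case: (top_add_root rtF f (faceF x) xfr); rewrite ?ffr.
case: (top_add_root rtF f (faceF x) xfr) => tE; first by constructor 3; apply: kid.
constructor 2; split=> //; rewrite (innerP vt dt) [ftop _ _]tE eqxx andbT; apply/negP.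
case/hull_add; rewrite ?in_setD1 ?fr' ?(negPf Cx) // => -[+ _]; exact/negP.
Qed.

(** Moving up the tree does not change the block until the hull is met, and from then on the path
    stays in the hull. *)
Lemma branch_inner C c u v : u \in V -> u \in hull C \/ u \in inner C c ->
  v \in vbranch u -> v \notin hull C -> v \in inner C c.
Proof.
move=> Vu + + Cv; move: u Vu; apply: (rt_ind rtV) => [|u Vu ur IH].
  by rewrite (branch_root rtV) in_set0.
move=> uC; rewrite (branchS rtV Vu ur) => /setU1P[vu|].
  by case: uC; rewrite -vu // => Cv'; rewrite Cv' in Cv.
apply: IH; case: uC => [Cu|Iu]; first by left; apply: (hull_parent vt).
have [|Cpu] := boolP (vpar tp u \in hull C); [by left | right].
move: Iu Cpu; rewrite -{1}(vt_flag vt Vu ur) /vpar !(innerP vt dt) ftop0.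
by move=> /andP[_ ->] ->.
Qed.

(** A vertex newly absorbed by the hull lies on a path from a corner of [f]; by [branch_inner] it
    was interior to the root block, not to the block of [c]. *)
Lemma inner_add_other C c f : C \subset F :\ fr -> c \in C ->
  f \in F :\ fr -> ftree C f = fr -> inner C c \subset inner (f |: C) c.
Proof.
move=> sC Cc Ff ffr; have cr : c != fr by case/setD1P: (subsetP sC c Cc).
apply/subsetP=> v /[dup]; rewrite {1}inE => /andP[/imsetP[x _ ->] _]; rewrite !(innerP vt dt).
case/andP=> Cx /eqP xc; apply/andP; split; last first.
  by rewrite /ftop (top_add_other rtF) ?faceF // -/(ftop C x) xc.
apply/negP=> /(hull_add Ff)[|[/bigcupP[y fy xy] _]]; first by apply/negP.
have yf : face_at y = f.
  by case/setD1P: Ff fy => _ /imsetP[z _ ->] /orb_eq.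
suff: vertex_at x \in inner C fr.
  by rewrite (innerP vt dt) xc (negPf cr) andbF.
apply: branch_inner (vertex_atV y) _ xy Cx; rewrite (innerP vt dt) /ftop yf ffr eqxx andbT.
by case: (vertex_at y \in hull C); [left|right].
Qed.

End Greedy.

(** Used with [t = 3 * r], [s = 2 * g * r + 1] and [M] the size of the root block. At most [l - 1]
    earlier cuts cost [2 * B] each, and three small blocks cost less than [3 * B]: in total less
    than [(2 * l + 1) * B], whence the factor [2 * l + 1]. *)
Lemma greedy_stop (l j n B M t s k : nat) : j < l -> (2 * l + 1) * k < B ->
  n = B + l * (t + s) -> M <= t + 3 * k ->
  (2 * l + 1) * n <= (2 * l + 1) * M + j * ((2 * l + 1) * t + 2 * B) + (2 * l + 1) * s ->
  False.
Proof.
case: l => // m; rewrite ltnS; set q := 2 * _ + 1 => le_jm qk -> le_M.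
have := leq_mul le_jm (leqnn (q * t + 2 * B)); have := leq_mul (leqnn q) le_M.
rewrite /q in qk *; nia.
Qed.

Lemma greedy_step (q j n B M M' t s k : nat) : q * k <= B -> M <= t + M' + 2 * k ->
  q * n <= q * M + j * (q * t + 2 * B) + q * s ->
  q * n <= q * M' + j.+1 * (q * t + 2 * B) + q * s.
Proof.
move=> qk le_M; have := leq_mul (leqnn q) le_M.
nia.
Qed.

(** * The greedy choice of the cuts *)

Section GreedyCuts.
Variable G : surface_graph.
Variables (vr : {set flag G}) (vd : {set flag G} -> nat).
Variable tp : {set flag G} -> flag G.
Hypothesis vt : vertex_tree vr vd tp.
Variables (fr : {set flag G}) (fd : {set flag G} -> nat).
Variable fp : {set flag G} -> flag G.
Hypothesis dt : dual_tree vr tp fr fd fp.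
Hypothesis tri : forall f, f \in faces G -> #|f| = 6.
Local Notation V := (vertices G).
Local Notation F := (faces G).
Local Notation rtF := (dt_tree dt).
Local Notation ftree := (top fr fd (fpar fp)).
Local Notation hull := (hull vr vd tp fr fp).
Local Notation inner := (inner vr vd tp fr fd fp).
Local Notation fkids := (kids F fr (fpar fp)).

Variables (l g r : nat).
Hypotheses (hg : has_euler_genus G g) (vd_le : forall v, v \in V -> vd v <= r).

Implicit Types C : {set {set flag G}}.

(** Without cuts there is one block, and only the hull of the [g] extra edges is lost. *)
Lemma card_inner_nocut : #|V| <= #|inner set0 fr| + (2 * g * r + 1).
Proof.
have sub : V \subset inner set0 fr :|: hull set0.
  apply/subsetP=> v /imsetP[x _ ->]; rewrite in_setU (innerP vt dt).
  have := top_mem rtF set0 (faceF x); rewrite setU0 in_set1 => /eqP xfr.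
  by rewrite /ftop xfr eqxx andbT; case: (_ \in _).
have c0 : #|cut_edges vr tp fr fp set0| = g.
  by rewrite /cut_edges imset0 setU0 (card_extra_edges vt dt hg).
have ch : #|hull set0 :\ vr| <= g * (2 * r) by rewrite -{1}c0; apply: card_hull.
have hullE : #|hull set0| <= 1 + g * (2 * r).
  by rewrite (cardsD1 vr) hull_root leq_add2l.
apply: leq_trans (subset_leq_card sub) _.
apply: leq_trans (leq_card_setU _ _) _; rewrite leq_add2l (leq_trans hullE) //.
by rewrite addnC mulnCA mulnA.
Qed.

Lemma card_inner_split C f k : f \in F ->
  (forall h, h \in fkids f -> ftree C h = fr -> #|inner (h |: C) h| <= k) ->
  #|inner C fr| <= 3 * r + (if f == fr then 0 else #|inner (f |: C) fr|) + #|fkids f| * k.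
Proof.
move=> Ff le_k.
pose K h := if ftree C h == fr then inner (h |: C) h else set0.
pose I := if f == fr then set0 else inner (f |: C) fr.
have sub : inner C fr \subset fbranch vd tp f :|: I :|: \bigcup_(h in fkids f) K h.
  apply/subsetP=> v /(inner_split vt dt Ff); rewrite !in_setU.
  case=> [-> //|[fr' Iv]|[h [kh hC Iv]]].
    by rewrite /I (negPf fr') Iv orbT.
  by apply/orP; right; apply/bigcupP; exists h; rewrite // /K hC eqxx.
apply: leq_trans (subset_leq_card sub) _; apply: leq_trans (leq_card_setU _ _) _.
apply: leq_add; last first.
  apply: leq_card_bigcup => h kh; rewrite /K.
  by case: eqP => [/(le_k h kh) //|_]; rewrite cards0.
apply: leq_trans (leq_card_setU _ _) _; apply: leq_add; first exact: card_fbranch.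
by rewrite /I; case: ifP; rewrite ?cards0.
Qed.

Variable B : nat.
Hypotheses (B_gt0 : 0 < B) (card_V : #|V| = B + l * ((3 + 2 * g) * r + 1)).
Let q := 2 * l + 1.

(** Sizes are scaled by [q] to avoid division. Each cut takes at most [3 * r] vertices and two
    blocks below the threshold from the root block; the last summand pays for the initial hull. *)
Lemma greedy_cuts j : j <= l -> exists C,
  [/\ C \subset F :\ fr, #|C| = j,
      forall c, c \in C -> B <= q * #|inner C c| &
      q * #|V| <= q * #|inner C fr| + j * (q * (3 * r) + 2 * B) + q * (2 * g * r + 1)].
Proof.
elim: j => [_|j IH lt_jl].
  exists set0; split; rewrite ?sub0set ?cards0 //; first by move=> c; rewrite in_set0.
  by rewrite mul0n addn0 -mulnDr leq_mul2l card_inner_nocut orbT.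
have [C [sC cC goodC big]] := IH (ltnW lt_jl); have q_gt0 : 0 < q by rewrite /q addn1.
(* The largest size of a block that misses the threshold [B <= q * size]. *)
pose k := B.-1 %/ q; have qk : q * k < B.
  by rewrite -[X in _ < X](ltn_predK B_gt0) ltnS mulnC leq_divM.
pose P f := [&& f \in F :\ fr, ftree C f == fr & B <= q * #|inner (f |: C) f|].
have badP h : h \in F :\ fr -> ftree C h = fr -> ~~ P h -> #|inner (h |: C) h| <= k.
  move=> Fh hC; rewrite /P Fh hC eqxx /= -ltnNge => lt_B.
  by rewrite leq_divRL // mulnC -ltnS (ltn_predK B_gt0).
have kidF f h : h \in fkids f -> h \in F :\ fr /\ fpar fp h = f.
  by rewrite inE in_setD1 => /and3P[-> -> /eqP].
have [/existsP[f0 Pf0]|/existsPn noP] := boolP [exists f, P f]; last first.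
  (* No face qualifies, so the root block is covered by the paths at the root face and at most three
     small blocks below it, contradicting [greedy_stop]. *)
  have Fr := rt_root rtF.
  have bad h : h \in fkids fr -> ftree C h = fr -> #|inner (h |: C) h| <= k.
    by move=> /kidF[Fh _] hC; apply: badP.
  have := card_inner_split Fr bad; rewrite eqxx addn0 => le_inner.
  have le3 := leq_mul (card_kids_root dt tri Fr) (leqnn k).
  case: (greedy_stop lt_jl qk _ _ big); first by rewrite card_V; lia.
  exact: leq_trans le_inner (leq_add (leqnn _) le3).
have [f Pf maxf] : exists2 f, P f & forall h, P h -> fd h <= fd f.
  by case: (arg_maxnP fd Pf0) => f ? ?; exists f.
case/and3P: (Pf) => Ff /eqP fC goodf; case/setD1P: (Ff) => fr' Ff'.
have fnC : f \notin C.
  by apply: contra fr' => Cf; rewrite -fC top_in // inE Cf orbT.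
exists (f |: C); split.
- by rewrite subUset sub1set Ff.
- by rewrite cardsU1 fnC cC.
- move=> c /setU1P[-> //|Cc]; apply: leq_trans (goodC c Cc) _.
  by rewrite leq_mul2l (subset_leq_card (inner_add_other vt dt sC Cc Ff fC)) orbT.
(* Children of [f] are deeper than [f], so by maximality they do not qualify. *)
have bad h : h \in fkids f -> ftree C h = fr -> #|inner (h |: C) h| <= k.
  move=> /kidF[Fh hf] hC; apply: badP => //; apply/negP=> /maxf.
  by case/setD1P: Fh => hr Fh; rewrite (rt_depthS rtF Fh hr) hf ltnn.
have := card_inner_split Ff' bad; rewrite (negPf fr') => le_inner.
have le2 := leq_mul (card_kids dt tri Ff' fr') (leqnn k).
by apply: greedy_step (ltnW qk) (leq_trans le_inner (leq_add (leqnn _) le2)) big.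
Qed.

End GreedyCuts.

Import Order.TTheory GRing.Theory Num.Theory.

Theorem theorem2p2 (l g r n : nat) (G : surface_graph)
    (hl : 0 < l)
    (hG : triangulation G)
    (hg : has_euler_genus G g)
    (hr : has_radius G r)
    (hn : #|vertices G| = n)
    (hlarge : (3 * l + 1) * ((3 + 2 * g) * r + 1) <= n) :
  exists S : subgraph G,
    [/\ #|sedges S| <= (2 * r + 1) * (g + l),
        two_cell S,
        #|sfaces S| = l + 1 &
        forall F, F \in sfaces S ->
          ((n%:R - l%:R * (3 + 2 * g%:R) * r%:R - l%:R) / (2 * l%:R + 1)
             <= #|interior_vertices F|%:R :> rat)%R].
Proof.
have [vr [vd [tp [vt vd_le]]]] := vertex_tree_exists hr.
have [fr [fd [fp dt]]] := dual_tree_exists vt.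
(* [B] is the numerator of the required bound. *)
set W := (3 + 2 * g) * r + 1 in hlarge; pose B := n - l * W.
have nE : n = B + l * W by rewrite subnK //; nia.
have B_gt0 : 0 < B by rewrite subn_gt0; rewrite /W in hlarge *; nia.
have card_V : #|vertices G| = B + l * W by rewrite hn.
have [C [sC cC goodC big]] := greedy_cuts vt dt (proj2 hG) hg vd_le B_gt0 card_V (leqnn l).
have good c : c \in fr |: C -> B <= (2 * l + 1) * #|inner vr vd tp fr fd fp C c|.
  (* For the root block, the invariant after [l] cuts leaves at least
     [(2 * l + 1) * B - 2 * l * B = B]. *)
  case/setU1P=> [->|/goodC //]; rewrite card_V in big.
  by rewrite /W in big; case: (l) hl big => // m _; nia.
exists (skel vt fr fp C); split.
- by rewrite -cC; apply: (card_skel_edges vt dt C hg vd_le).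
- by move=> A; rewrite (skel_sfaces vt dt sC) => /imsetP[c Cc ->]; apply: region_disc.
- by rewrite (card_skel_sfaces vt dt sC) cC.
move=> A; rewrite (skel_sfaces vt dt sC) => /imsetP[c Cc ->].
rewrite (region_interior vt dt sC Cc); have := good c Cc.
move: #|_| => m le_m; rewrite -[(2 * l%:R)%R]natrM natr1 ler_pdivrMr ?ltr0n //.
rewrite !lerBlDr -!(natrM, natrD) ler_nat {1}nE /W; lia.
Qed.
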